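(* Let $k$ be a field and let $G$ be a simple graph. Suppose that $G$ contains an induced subgraph which is the disjoint union of graphs $H_1,\dots,H_s$. Then (1) $\operatorname{reg} k[G] \ge \sum_{i=1}^s \operatorname{reg} k[H_i]$. (2) $\operatorname{pd} k[G] \ge \sum_{i=1}^s \operatorname{pd} k[H_i]$.
   Context: Graphs are finite and simple (no loops, no multiple edges). A subgraph $H$ of $G$ is induced if for all vertices $x,y$ of $H$, $\{x,y\}$ is an edge of $H$ if and only if it is an edge of $G$. For a graph $G=(V,E)$, let $k[V]$ and $k[E]$ be the polynomial rings over $k$ whose variables are the vertices, respectively the edges, of $G$. The toric ring $k[G]$ is the image of the $k$-algebra homomorphism $\phi_G: k[E]\to k[V]$ sending the variable $e=\{x,y\}\in E$ to $xy$. Via $\phi_G$, $k[G]$ is a graded module over the standard graded polynomial ring $k[E]$ (each edge variable has degree $1$). With $\beta_{i,j}(k[G])$ the graded Betti numbers of $k[G]$ over $k[E]$, $\operatorname{reg} k[G]=\max\{j-i : \beta_{i,j}(k[G])\neq 0\}$ is the Castelnuovo-Mumford regularity and $\operatorname{pd} k[G]=\max\{i : \beta_{i,j}(k[G])\ne 0 \text{ for some } j\}$ is the projective dimension over $k[E]$. The same conventions apply to each $k[H_i]$ over the polynomial ring on the edges of $H_i$. *)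

(* Defs.v *)
From HB Require Import structures.
From mathcomp Require Import all_boot all_order all_algebra.
From mathcomp Require Import mpoly.

Set Implicit Arguments.
Unset Strict Implicit.
Unset Printing Implicit Defensive.

Import Order.TTheory GRing.Theory Num.Theory.
Local Open Scope ring_scope.

Record sgraph := SGraph {
  vertex :> finType;
  adj : rel vertex;
  adj_sym : ssrbool.symmetric adj;
  adj_irrefl : irreflexive adj }.

Definition graph_iso (G H : sgraph) : Prop :=
  exists f : G -> H, bijective f /\ forall x y, adj (f x) (f y) = adj x y.

Section Induced.
Variables (G : sgraph) (U : {set G}).

Definition induced_adj : rel {x : G | x \in U} :=
  fun x y => adj (val x) (val y).

Lemma induced_adj_sym : ssrbool.symmetric induced_adj.
Proof. by move=> x y; apply: adj_sym. Qed.

Lemma induced_adj_irrefl : irreflexive induced_adj.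
Proof. by move=> x; apply: adj_irrefl. Qed.

Definition induced : sgraph := SGraph induced_adj_sym induced_adj_irrefl.
End Induced.

Section DisjointUnion.
Variables (s : nat) (H : 'I_s -> sgraph).

(* [tagged_as x y] is [tagged y] transported to the component of [x]; it is
   meaningful because the tags are first required to agree. *)
Definition disjoint_union_adj : rel {i : 'I_s & H i} :=
  fun x y => (tag x == tag y) && adj (tagged x) (tagged_as x y).

Lemma disjoint_union_adj_sym : ssrbool.symmetric disjoint_union_adj.
Proof.
move=> [i x] [j y]; rewrite /disjoint_union_adj /=.
case: (eqVneq i j) => [eij|//]; case: j / eij y => y /=.
by rewrite !tagged_asE adj_sym.
Qed.

Lemma disjoint_union_adj_irrefl : irreflexive disjoint_union_adj.
Proof.
by move=> [i x]; rewrite /disjoint_union_adj eqxx tagged_asE adj_irrefl.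
Qed.

Definition disjoint_union : sgraph :=
  SGraph disjoint_union_adj_sym disjoint_union_adj_irrefl.
End DisjointUnion.

Definition edges (G : sgraph) : {set {set G}} :=
  [set [set p.1; p.2] | p : G * G & adj p.1 p.2].

(* The variables of [kE k G] and [kV k G] are indexed by ordinals, through the
   enumerations of the edges and of the vertices of [G]. *)
Notation kV k G := {mpoly k[#|{: vertex G}|]}.
Notation kE k G := {mpoly k[#|edges G|]}.

Section ToricRing.
Variables (k : fieldType) (G : sgraph).

Definition edge_monomial (i : 'I_#|edges G|) : kV k G :=
  \prod_(x in (enum_val i : {set G})) 'X_(enum_rank x).

Definition toric_map (q : kE k G) : kV k G :=
  q \mPo [tuple edge_monomial i | i < #|edges G|].

Definition toric_ring (f : kV k G) : Prop :=
  exists q : kE k G, f = toric_map q.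

(* Edge variables have degree 1, so the degree d component of [toric_ring]
   consists of polynomials of degree 2d in the vertex variables. *)
Definition toric_component (d : nat) (f : kV k G) : Prop :=
  exists2 q : kE k G, q \is d.-homog & f = toric_map q.
End ToricRing.

(* [u] is homogeneous of degree [D] in the graded free module
   \bigoplus_c S(- deg c). *)
Definition homogeneous_row (k : fieldType) (n b : nat) (deg : 'I_b -> nat)
    (D : nat) (u : 'rV[{mpoly k[n]}]_b) : Prop :=
  forall c, if (deg c <= D)%N then u 0 c \is (D - deg c)%N.-homog
            else u 0 c == 0.

(* Minimal graded free resolution of the [kE k G]-module [toric_ring],
     ... -> F_2 -> F_1 -> F_0 -> k[G] -> 0,
   where F_i has a basis of [rk i] elements of degrees [deg i]. Maps act on row
   vectors from the right, and [kE k G] acts on [toric_ring] through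
   [toric_map]. Natural numbers suffice for degrees, as k[G] lives in
   nonnegative degrees and hence so do its minimal syzygies. *)
Record min_graded_free_resolution (k : fieldType) (G : sgraph) := MinRes {
  rk : nat -> nat;
  deg : forall i, 'I_(rk i) -> nat;
  dif : forall i, 'M[kE k G]_(rk i.+1, rk i);
  aug : 'cV[kV k G]_(rk 0);
  aug_homogeneous : forall a, toric_component (deg a) (aug a 0);
  aug_surjective : forall f : kV k G, toric_ring f ->
    exists u : 'rV[kE k G]_(rk 0), (map_mx (@toric_map k G) u *m aug) 0 0 = f;
  dif_homogeneous : forall i (a : 'I_(rk i.+1)),
    homogeneous_row (@deg i) (deg a) (row a (dif i));
  exact_aug : forall u : 'rV[kE k G]_(rk 0),
    map_mx (@toric_map k G) u *m aug = 0 <->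
    exists v : 'rV[kE k G]_(rk 1), u = v *m dif 0;
  exact_dif : forall i (u : 'rV[kE k G]_(rk i.+1)),
    u *m dif i = 0 <->
    exists v : 'rV[kE k G]_(rk i.+2), u = v *m dif i.+1;
  (* entries of the differentials lie in the ideal of the variables *)
  dif_minimal : forall i a c, (dif i a c)@_0%MM = 0 }.

Definition betti (k : fieldType) (G : sgraph)
    (F : min_graded_free_resolution k G) (i j : nat) : nat :=
  #|[set a : 'I_(rk F i) | deg a == j]|.

Definition is_maximum (d : Order.disp_t) (T : porderType d) (P : T -> Prop)
    (m : T) : Prop :=
  P m /\ forall x, P x -> (x <= m)%O.

(* [is_reg k G r]: reg k[G] = r, computed on a minimal graded free resolution.
   Such a resolution exists and the graded Betti numbers do not depend on it. *)
Definition is_reg (k : fieldType) (G : sgraph) (r : int) : Prop :=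
  exists F : min_graded_free_resolution k G,
    is_maximum (fun x : int =>
      exists i j : nat, betti F i j != 0%N /\ x = j%:Z - i%:Z) r.

Definition is_pd (k : fieldType) (G : sgraph) (p : nat) : Prop :=
  exists F : min_graded_free_resolution k G,
    is_maximum (fun i : nat => exists j : nat, betti F i j != 0%N) p.

(* Main.v *)
From HB Require Import structures.
Require Import Defs.
From mathcomp Require Import all_boot all_order all_algebra.
From mathcomp Require Import mpoly boolp.
Import Order.TTheory GRing.Theory Num.Theory.
Local Open Scope ring_scope.
Set Implicit Arguments.
Unset Strict Implicit.
Unset Printing Implicit Defensive.

(* By minimality, the graded Betti numbers of k[G] are detected by the Koszul
   homology of k[G] over k[E], shifting degrees along the given resolution:
   free modules have no higher Koszul homology, because the variables form a
   regular sequence in any order. Koszul homology is graded by the monomials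
   of k[V], although the resolution need not be, and in multidegree h it is the
   reduced homology of the complex of the sets s of edges such that h - sum s is
   a sum of edges. For h supported on the disjoint union of the H_i this complex
   only involves edges of the H_i and is the join of the complexes of the H_i;
   products of non-trivial cycles stay non-trivial over a field. So nonzero
   beta_{a_i,j_i}(k[H_i]) for all i force beta_{sum a_i, sum j_i}(k[G]) to be
   nonzero, which gives both inequalities. *)

(** * Koszul complexes *)

(** No homology group is formed: a class is a cycle that bounds nothing in its degree. Nonvanishing
    is all that the inequalities need, and it allows diagram chases in short exact sequences 0 -> Z
    -> F_i -> Z' -> 0 instead of the symmetry of Tor, and a single linear functional instead of the
    Künneth formula. Modules such as k[G], its graded pieces and the syzygies are predicates on an
    ambient group, with no types of their own. Graded pieces are indexed by degree plus one, because
    degrees are natural numbers with truncated subtraction: index 0 is then the zero module. The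
    complex is built on a list of variables, since acyclicity is proved one variable at a time and
    the join needs the edges listed component by component. *)

(* The Koszul complex as an iterated mapping cone: the first component of a pair
   collects the faces that avoid the head of the list, the second one those that
   contain it. *)
Fixpoint koszul (I : Type) (V : zmodType) (xs : seq I) : zmodType :=
  if xs is _ :: xs' then (koszul V xs' * koszul V xs')%type else V.

Fixpoint kmap (I : Type) (V W : zmodType) (f : V -> W) (xs : seq I) :
    koszul V xs -> koszul W xs :=
  if xs is _ :: xs' return koszul V xs -> koszul W xs
  then fun u => (kmap f u.1, kmap f u.2) else f.

Fixpoint kdiff (I : Type) (V : zmodType) (act : I -> {additive V -> V})
    (xs : seq I) : koszul V xs -> koszul V xs :=
  if xs is x :: xs' return koszul V xs -> koszul V xs
  then fun u => (kdiff act u.1 + kmap (act x) u.2, - kdiff act u.2)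
  else fun=> 0.

(* Chains of homological degree [a] with coefficients in [Q]. *)
Fixpoint kin (I : Type) (V : zmodType) (Q : V -> Prop) (xs : seq I) (a : nat) :
    koszul V xs -> Prop :=
  if xs is _ :: xs' return koszul V xs -> Prop
  then fun u => kin Q a u.1 /\ (if a is a'.+1 then kin Q a' u.2 else u.2 = 0)
  else fun u => if a is 0%N then Q u else u = 0.

Fixpoint kinj (I : Type) (V : zmodType) (xs : seq I) (v : V) : koszul V xs :=
  if xs is _ :: xs' return koszul V xs then (kinj xs' v, 0) else v.

Section Koszul.
Variable I : Type.
Implicit Types (xs : seq I) (a : nat).

Lemma kinjD (V : zmodType) xs : {morph @kinj I V xs : u v / u + v}.
Proof. by elim: xs => //= x xs IH u v; rewrite IH; congr (_, _);
  rewrite /= addr0. Qed.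

Lemma kinjN (V : zmodType) xs : {morph @kinj I V xs : u / - u}.
Proof. by elim: xs => //= x xs IH u; rewrite IH; congr (_, _);
  rewrite /= oppr0. Qed.

Lemma kinj_inj (V : zmodType) xs : injective (@kinj I V xs).
Proof. by elim: xs => //= x xs IH u v [/IH]. Qed.

Section Map.
Variables (V W : zmodType) (f : {additive V -> W}).

Fact kmap_is_zmod_morphism xs : zmod_morphism (@kmap I V W f xs).
Proof.
elim: xs => [|x xs IH] /= u v; first exact: raddfB.
by rewrite !IH.
Qed.

HB.instance Definition _ xs :=
  GRing.isZmodMorphism.Build (koszul V xs) (koszul W xs) (@kmap I V W f xs)
    (@kmap_is_zmod_morphism xs).

Lemma kmap_kinj xs (v : V) : kmap f (kinj xs v) = kinj xs (f v).
Proof. by elim: xs => //= x xs ->; rewrite raddf0. Qed.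

Lemma kin_kmap (Q : V -> Prop) (R : W -> Prop) xs a (u : koszul V xs) :
  (forall v, Q v -> R (f v)) -> kin Q a u -> kin R a (kmap f u).
Proof.
move=> QR; elim: xs a u => [|x xs IH] [|a] u /=.
- exact: QR.
- by move=> ->; rewrite raddf0.
- by case=> ? ->; rewrite raddf0; split; first exact: IH.
- by case=> ? ?; split; apply: IH.
Qed.

Lemma kin_lift (Q : V -> Prop) (R : W -> Prop) xs a (w : koszul W xs) :
  (forall w', R w' -> exists2 v, Q v & w' = f v) -> kin R a w ->
  exists2 u, kin Q a u & w = kmap f u.
Proof.
move=> QR; elim: xs a w => [|x xs IH] [|a] w /=.
- exact: QR.
- by move=> ->; exists 0; rewrite ?raddf0.
- case: w => w1 w2 /= [/IH[u1 Qu1 ->] ->].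
  by exists (u1, 0); rewrite //= raddf0.
- case: w => w1 w2 /= [/IH[u1 Qu1 ->] /IH[u2 Qu2 ->]].
  by exists (u1, u2).
Qed.

Lemma kin_ker (Q R : V -> Prop) xs a (u : koszul V xs) :
  (forall v, Q v -> f v = 0 -> R v) -> kin Q a u -> kmap f u = 0 -> kin R a u.
Proof.
move=> QR; elim: xs a u => [|x xs IH] [|a] u //=.
- exact: QR.
- by case: u => u1 u2 /= [/IH + ->] [] => Qu1 /Qu1.
- by case: u => u1 u2 /= [/IH Q1 /IH Q2] [] /Q1 ? /Q2.
Qed.

Lemma kmap_eq0 (Q : V -> Prop) xs a (u : koszul V xs) :
  (forall v, Q v -> f v = 0) -> kin Q a u -> kmap f u = 0.
Proof.
move=> Qf; elim: xs a u => [|x xs IH] [|a] u //=.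
- exact: Qf.
- by move=> ->; rewrite raddf0.
- by case: u => u1 u2 /= [/IH -> ->]; rewrite raddf0.
- by case: u => u1 u2 /= [/IH -> /IH ->].
Qed.
End Map.

Lemma kin_imp (V : zmodType) (Q R : V -> Prop) xs a (u : koszul V xs) :
  (forall v, Q v -> R v) -> kin Q a u -> kin R a u.
Proof.
move=> QR; elim: xs a u => [|x xs IH] [|a] u //=.
- exact: QR.
- by case=> /IH.
- by case=> /IH ? /IH.
Qed.

Lemma kin_eq0 (V : zmodType) (Q : V -> Prop) xs a (u : koszul V xs) :
  (forall v, Q v -> v = 0) -> kin Q a u -> u = 0.
Proof.
move=> Q0; elim: xs a u => [|x xs IH] [|a] u //=.
- exact: Q0.
- by case: u => u1 u2 /= [/IH -> ->].
- by case: u => u1 u2 /= [/IH -> /IH ->].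
Qed.

Section Diff.
Variables (V : zmodType) (act : I -> {additive V -> V}).

Fact kdiff_is_zmod_morphism xs : zmod_morphism (@kdiff I V act xs).
Proof.
elim: xs => [|x xs IH] /= u v; first by rewrite subr0.
rewrite !IH raddfB; congr (_, _) => /=; last by rewrite opprB opprK addrC.
by rewrite addrACA opprD.
Qed.

HB.instance Definition _ xs :=
  GRing.isZmodMorphism.Build (koszul V xs) (koszul V xs) (@kdiff I V act xs)
    (@kdiff_is_zmod_morphism xs).

Lemma kdiff_kinj xs v : kdiff act (kinj xs v) = 0.
Proof. by elim: xs => //= x xs ->; rewrite !raddf0 addr0. Qed.

Lemma kmap_kdiff (W : zmodType) (actW : I -> {additive W -> W})
    (f : {additive V -> W}) xs (u : koszul V xs) :
  (forall x v, f (act x v) = actW x (f v)) ->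
  kmap f (kdiff act u) = kdiff actW (kmap f u).
Proof.
move=> fact; have kmap_comp x ys : forall w : koszul V ys,
    kmap f (kmap (act x) w) = kmap (actW x) (kmap f w).
  by elim: ys => [|y ys IH] w /=; rewrite ?fact ?IH.
elim: xs u => [|x xs IH] u /=; first exact: raddf0.
by rewrite raddfN raddfD /= !IH kmap_comp.
Qed.
End Diff.

Lemma kdiffK (V : zmodType) (act : I -> {additive V -> V}) xs
    (u : koszul V xs) :
  (forall x y v, act x (act y v) = act y (act x v)) ->
  kdiff act (kdiff act u) = 0.
Proof.
move=> actC; elim: xs u => [|x xs IH] u //=.
have -> : kdiff act (- kdiff act u.2) = 0 by rewrite raddfN /= IH oppr0.
rewrite raddfD raddfN /= IH add0r oppr0.
by rewrite (@kmap_kdiff _ act _ act (act x)) ?subrr // => y v; rewrite actC.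
Qed.

Lemma kin_degree0 (V : zmodType) (Q : V -> Prop) xs (u : koszul V xs) :
  kin Q 0 u -> exists2 v, Q v & u = kinj xs v.
Proof.
elim: xs u => [|x xs IH] u /=; first by exists u.
by case: u => u1 u2 /= [/IH[v Qv ->] ->]; exists v.
Qed.

Section In.
Variables (V : zmodType) (Q : V -> Prop).
Hypotheses (Q0 : Q 0) (QB : forall u v, Q u -> Q v -> Q (u - v)).

Lemma kin0 xs a : kin Q a (0 : koszul V xs).
Proof. by elim: xs a => [|x xs IH] [|a] /=; try split. Qed.

Lemma kinB xs a (u v : koszul V xs) :
  kin Q a u -> kin Q a v -> kin Q a (u - v).
Proof.
elim: xs a u v => [|x xs IH] [|a] u v /=.
- exact: QB.
- by move=> -> ->; rewrite subr0.
- by move=> [? ->] [? ->]; rewrite subr0; split; first exact: IH.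
- by move=> [? ?] [? ?]; split; apply: IH.
Qed.

Lemma kinN xs a (u : koszul V xs) : kin Q a u -> kin Q a (- u).
Proof. by rewrite -[- u]add0r; apply/kinB/kin0. Qed.

Lemma kinD xs a (u v : koszul V xs) :
  kin Q a u -> kin Q a v -> kin Q a (u + v).
Proof. by move=> Qu /kinN Qv; rewrite -[v]opprK; apply: kinB. Qed.

Lemma kin_kinj xs v : Q v -> kin Q 0 (kinj xs v).
Proof. by elim: xs => //= x xs IH /IH. Qed.

Lemma kin_kdiff (act : I -> {additive V -> V}) (R : V -> Prop) xs a
    (u : koszul V xs) :
  (forall x v, R v -> Q (act x v)) -> kin R a.+1 u -> kin Q a (kdiff act u).
Proof.
move=> RQ; elim: xs a u => [|x xs IH] a u /=.
  by case: a.
case=> /IH Q1 R2; split.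
  by apply: kinD => //; apply: kin_kmap R2 => v; apply: RQ.
case: a {Q1} R2 => [/kin_degree0[v _ ->]|a /IH]; last exact: kinN.
by rewrite kdiff_kinj oppr0.
Qed.
End In.
End Koszul.

(* [Q e] stands for the component of degree [e - 1] of a graded module (so that
   [Q 0] is zero): the Koszul homology of homological degree [a] and internal
   degree [a + e - 1] does not vanish. *)
Definition koszul_homology_neq0 (I : Type) (V : zmodType)
    (act : I -> {additive V -> V}) (Q : nat -> V -> Prop) (xs : seq I)
    (a e : nat) : Prop :=
  exists z : koszul V xs, [/\ kin (Q e) a z, kdiff act z = 0 &
    forall t, kin (Q e.-1) a.+1 t -> z <> kdiff act t].

(** * Dimension shifting along a surjection from an acyclic module *)

Section Shift.
Variables (I : Type) (V W : zmodType) (f : {additive V -> W}).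
Variables (actV : I -> {additive V -> V}) (actW : I -> {additive W -> W}).
Variables (QV : nat -> V -> Prop) (QW : nat -> W -> Prop) (xs : seq I).

Let QZ e v := QV e v /\ f v = 0.

Hypothesis actVC : forall x y v, actV x (actV y v) = actV y (actV x v).
Hypothesis f_act : forall x v, f (actV x v) = actW x (f v).
Hypothesis QV0 : forall e, QV e 0.
Hypothesis QVB : forall e u v, QV e u -> QV e v -> QV e (u - v).
Hypothesis QV_act : forall e x v, QV e.-1 v -> QV e (actV x v).
Hypothesis QW_f : forall e v, QV e v -> QW e (f v).
Hypothesis QW_lift : forall e w, QW e w -> exists2 v, QV e v & w = f v.
Hypothesis acyclic : forall e a (u : koszul V xs), kin (QV e) a.+1 u ->
  kdiff actV u = 0 -> exists2 t, kin (QV e.-1) a.+2 t & u = kdiff actV t.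
Hypothesis minimal : forall e v, QZ e v ->
  exists2 t : koszul V xs, kin (QV e.-1) 1 t & kinj xs v = kdiff actV t.

Let kinZV e a (u : koszul V xs) : kin (QZ e) a u -> kin (QV e) a u.
Proof. by apply: kin_imp => v []. Qed.

Let kinZ e a (u : koszul V xs) :
  kin (QV e) a u -> kmap f u = 0 -> kin (QZ e) a u.
Proof. by apply: kin_ker => v. Qed.

Let kinZ0 e a (u : koszul V xs) : kin (QZ e) a u -> kmap f u = 0.
Proof. by apply: kmap_eq0 => v []. Qed.

Let kinVd e a (u : koszul V xs) :
  kin (QV e.-1) a.+1 u -> kin (QV e) a (kdiff actV u).
Proof. by apply: kin_kdiff => // [u' v'|x v]; [apply: QVB|apply: QV_act]. Qed.

Let kmapd (u : koszul V xs) : kmap f (kdiff actV u) = kdiff actW (kmap f u).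
Proof. exact: kmap_kdiff. Qed.

Let kinVB e a (u v : koszul V xs) :
  kin (QV e) a u -> kin (QV e) a v -> kin (QV e) a (u - v).
Proof. by apply: kinB; apply: QVB. Qed.

(** The inverse of the connecting map: a cycle with coefficients in the kernel of [f] bounds in [V],
    and the image under [f] of a bounding chain is the new cycle. In homological degree 0 acyclicity
    is silent and [minimal] takes over. *)
Lemma koszul_homology_ker_to_im a e :
  koszul_homology_neq0 actV QZ xs a e ->
  koszul_homology_neq0 actW QW xs a.+1 e.-1.
Proof.
case=> z [Qz dz0 zNd].
have [y Qy zE] : exists2 y, kin (QV e.-1) a.+1 y & z = kdiff actV y.
  case: a Qz {zNd} => [/kin_degree0[v Qv ->]|a Qz]; first exact: minimal.
  by apply: acyclic => //; apply: kinZV.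
exists (kmap f y); split; first by apply: kin_kmap Qy; apply: QW_f.
  by rewrite -kmapd -zE; apply: kinZ0 Qz.
move=> t /(kin_lift (@QW_lift _))[t' Qt' ->] fy.
(* Subtracting the boundary of a lift moves [y] into the kernel without changing its
   differential. *)
apply: (zNd (y - kdiff actV t')).
  apply: kinZ; first by apply: kinVB => //; apply: kinVd.
  by rewrite raddfB /= kmapd fy subrr.
by rewrite raddfB /= kdiffK // subr0.
Qed.

(** The connecting map itself: the differential of a lift has coefficients in the kernel. If it
    bounded there, acyclicity of [V] would make the lift a boundary up to kernel terms. *)
Lemma koszul_homology_im_to_ker a e :
  koszul_homology_neq0 actW QW xs a.+1 e ->
  koszul_homology_neq0 actV QZ xs a e.+1.
Proof.
case=> z [/(kin_lift (@QW_lift _))[y Qy ->] dz0 zNd].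
exists (kdiff actV y); split.
- by apply: kinZ; [apply: kinVd|rewrite kmapd].
- exact: kdiffK.
move=> w Qw dy.
have [||t Qt yE] := @acyclic e a (y - w).
- by apply: kinVB => //; apply: kinZV.
- by rewrite raddfB /= dy subrr.
apply: (zNd (kmap f t)); first by apply: kin_kmap Qt; apply: QW_f.
by rewrite -kmapd -yE raddfB /= (kinZ0 Qw) subr0.
Qed.

(** [V] and [W] agree modulo the variables, because [minimal] puts the kernel of [f] inside the
    submodule that the variables generate. *)
Lemma koszul_homology0_im e :
  koszul_homology_neq0 actW QW xs 0 e <->
  exists2 v, QV e v &
    forall t : koszul V xs, kin (QV e.-1) 1 t -> kinj xs v <> kdiff actV t.
Proof.
split=> [[z [/kin_degree0[w /QW_lift[v Qv ->] ->] _ zNd]]|[v Qv vNd]].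
  exists v => // t Qt vE; apply: (zNd (kmap f t)).
    by apply: kin_kmap Qt; apply: QW_f.
  by rewrite -kmapd -vE kmap_kinj.
exists (kinj xs (f v)); split; first by apply: kin_kinj; apply: QW_f.
  exact: kdiff_kinj.
move=> t /(kin_lift (@QW_lift _))[t' Qt' ->] fv.
have /kin_degree0[v' /minimal[s Qs v'E] vE] :
    kin (QZ e) 0 (kinj xs v - kdiff actV t').
  apply: kinZ; first by apply: kinVB; [apply: kin_kinj|apply: kinVd].
  by rewrite raddfB /= kmapd -fv kmap_kinj subrr.
apply: (vNd (s + t')); first by apply: kinD => //; apply: QVB.
by rewrite raddfD /= -v'E -vE subrK.
Qed.
End Shift.

(** * Free modules over polynomial rings *)

Lemma mcoeffXM (R : nzRingType) n (m : 'X_{1..n}) (p : {mpoly R[n]}) l :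
  ('X_[m] * p)@_l = if (m <= l)%MM then p@_(l - m) else 0.
Proof.
rewrite -(commr_mpolyX m p); case: ifP => [ml|mNl].
  by rewrite -{1}(submK ml) addmC mcoeffMX.
apply/eqP; rewrite -[_ == 0]negbK -mcoeff_msupp (perm_mem (msuppMX p m)).
by apply/negP => /mapP[l' _ lE]; rewrite lE lem_addr in mNl.
Qed.

Lemma mpoly_of_coeff (R : nzRingType) n (s : seq 'X_{1..n})
    (f : 'X_{1..n} -> R) : (forall m, m \notin s -> f m = 0) ->
  exists p : {mpoly R[n]}, forall m, p@_m = f m.
Proof.
move=> fs; exists (\sum_(l <- undup s) f l *: 'X_[l]) => m.
rewrite raddf_sum /=; under eq_bigr do rewrite mcoeffZ mcoeffX.
have [ms|mNs] := boolP (m \in s).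
  rewrite (bigD1_seq m) ?mem_undup ?undup_uniq //= eqxx mulr1 big1 ?addr0 //.
  by move=> l /negbTE ->; rewrite mulr0.
rewrite fs // big_seq big1 // => l; rewrite mem_undup => ls.
by case: eqP ls => [-> ms|]; rewrite ?mulr0 // ms in mNs *.
Qed.

Section FreeModule.
Variables (k : fieldType) (n b : nat) (deg : 'I_b -> nat).
Local Notation V := 'rV[{mpoly k[n]}]_b.
Implicit Types (D : nat -> Prop) (u v : V) (xs : seq 'I_n).

(** Degrees are constrained by a predicate so that the complement of a degree is covered too, as
    [row_proj] requires. *)
Definition row_in D u :=
  forall c m, (u 0 c)@_m != 0 -> D (mdeg m + deg c)%N.

Definition row_deg e := row_in (fun d => d.+1 = e).

Lemma row_in0 D : row_in D 0.
Proof. by move=> c m; rewrite mxE mcoeff0 eqxx. Qed.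

Lemma row_inB D u v : row_in D u -> row_in D v -> row_in D (u - v).
Proof.
move=> Du Dv c m; rewrite !mxE mcoeffB.
have [vE|/Dv //] := eqVneq ((v 0 c)@_m) 0.
by rewrite vE subr0 => /Du.
Qed.

Lemma row_in_disjoint D D' u :
  row_in D u -> row_in D' u -> (forall d, D d -> D' d -> False) -> u = 0.
Proof.
move=> Du D'u DD'; apply/rowP => c; apply/mpolyP => m.
rewrite mxE mcoeff0; apply/eqP; apply: contraPT isT => /[dup] /Du Dm /D'u.
by move=> /(DD' _ Dm).
Qed.

Definition mulX (i : 'I_n) : {additive V -> V} := *:%R 'X_i.

Lemma mulXC i j u : mulX i (mulX j u) = mulX j (mulX i u).
Proof. by rewrite /mulX /= !scalerA mulrC. Qed.

Lemma mulXE i u c m :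
  (mulX i u 0 c)@_m = if m i != 0%N then (u 0 c)@_(m - U_(i)) else 0.
Proof. by rewrite mxE mcoeffXM lep1mP. Qed.

Lemma row_deg_mulX e i u : row_deg e.-1 u -> row_deg e (mulX i u).
Proof.
move=> eu c m; rewrite mulXE; case: ifP => [mi /eu|]; last by rewrite eqxx.
have {2}-> : m = (m - U_(i) + U_(i))%MM by rewrite submK // lep1mP.
by rewrite mdegD mdeg1 addn1 addSn; case: e {eu} => [|e] //= ->.
Qed.

(** Membership in the submodule generated by the variables in [xs], read off the coefficients. *)
Definition vanishing xs u :=
  forall c (m : 'X_{1..n}), (forall i, i \in xs -> m i = 0%N) -> (u 0 c)@_m = 0.

Lemma row_split e i u : row_deg e u -> exists u1 u2,
  [/\ row_deg e.-1 u1, row_deg e u2, u = mulX i u1 + u2 &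
      forall c m, (u2 0 c)@_m = if m i != 0%N then 0 else (u 0 c)@_m].
Proof.
move=> eu.
have /choice[q qE] : forall c, exists p : {mpoly k[n]},
    forall m, p@_m = (u 0 c)@_(m + U_(i)).
  (* A superset of the support suffices, so it does no harm that truncated subtraction also maps
     monomials without the variable [i]. *)
  move=> c; apply: (@mpoly_of_coeff _ _
    [seq (m - U_(i))%MM | m <- msupp (u 0 c)]) => m mN.
  apply: memN_msupp_eq0; apply: contra mN => mu.
  by apply/mapP; exists (m + U_(i))%MM; rewrite ?addmK.
pose u1 : V := \row_c q c.
have u2E c m : ((u - mulX i u1) 0 c)@_m =
    if m i != 0%N then 0 else (u 0 c)@_m.
  rewrite mxE mcoeffD mxE mcoeffN mulXE mxE qE; case: ifP => mi /=;
    last by rewrite subr0.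
  by rewrite submK ?subrr // lep1mP.
exists u1, (u - mulX i u1); split=> //; last by rewrite addrC subrK.
  move=> c m; rewrite mxE qE => /eu <- /=.
  by rewrite mdegD mdeg1 addn1.
by move=> c m; rewrite u2E; case: ifP => [|_ /eu]; rewrite ?eqxx.
Qed.

(** Serves to make preimages homogeneous, as exactness of the resolution is stated without
    degrees. *)
Lemma row_proj D u : exists u1 u2,
  [/\ row_in D u1, row_in (fun d => ~ D d) u2 & u = u1 + u2].
Proof.
have /choice[q qE] : forall c, exists p : {mpoly k[n]},
    forall m, p@_m = if `[< D (mdeg m + deg c)%N >] then (u 0 c)@_m else 0.
  move=> c; apply: (@mpoly_of_coeff _ _ (msupp (u 0 c))) => m /memN_msupp_eq0
    ->.
  by case: ifP.
exists (\row_c q c), (u - \row_c q c); split; last by rewrite addrC subrK.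
  by move=> c m; rewrite mxE qE; case: asboolP; rewrite ?eqxx.
by move=> c m; rewrite !mxE mcoeffB qE; case: asboolP; rewrite ?subrr ?eqxx.
Qed.

Lemma vanishing0 xs : vanishing xs 0.
Proof. by move=> c m _; rewrite mxE mcoeff0. Qed.

Lemma vanishing_mulX i xs u :
  i \notin xs -> vanishing xs (mulX i u) -> vanishing xs u.
Proof.
move=> iN xu c m m0; have := xu c (m + U_(i))%MM; rewrite mulXE mnmDE mnm1E.
rewrite eqxx addn1 /= addmK; apply=> j jxs; rewrite mnmDE m0 // mnm1E.
by case: eqP jxs iN => // -> ->.
Qed.

Lemma vanishing_mulX_split i xs u v :
  vanishing xs u -> vanishing (i :: xs) (u + mulX i v).
Proof.
move=> xu c m m0; rewrite mxE mcoeffD mulXE m0 ?mem_head //= addr0 xu // => j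
  jxs.
by rewrite m0 // in_cons jxs orbT.
Qed.

(** Together with [vanishing_kdiff1], this identifies the image of the first differential with the
    submodule generated by the variables. *)
Lemma kdiff1_vanishing (Q : V -> Prop) xs (t : koszul V xs) :
  kin Q 1 t -> exists2 v, kdiff mulX t = kinj xs v & vanishing xs v.
Proof.
elim: xs t => [|x xs IH]; first by exists 0 => //; apply: vanishing0.
case=> t1 t2 /= [/IH[v -> xv] /kin_degree0[w _ ->]].
exists (v + mulX x w); last exact: vanishing_mulX_split.
by rewrite kmap_kinj kdiff_kinj oppr0 kinjD.
Qed.

Lemma vanishing_kdiff1 e xs v : row_deg e v -> vanishing xs v ->
  exists2 t : koszul V xs, kin (row_deg e.-1) 1 t & kinj xs v = kdiff mulX t.
Proof.
elim: xs v => [|x xs IH] v ev xv.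
  by exists 0 => //=; apply/rowP => c; apply/mpolyP => m;
    rewrite xv // mxE mcoeff0.
have [v1 [v2 [ev1 ev2 vE v2E]]] := row_split x ev.
have [|t2 et2 t2E] := IH _ ev2.
  move=> c m m0; rewrite v2E; case: ifP => // /negbFE/eqP mx.
  by apply: xv => i; rewrite in_cons => /orP[/eqP ->|/m0].
exists (t2, kinj xs v1); first by split=> //; apply: kin_kinj.
by rewrite /= vE -t2E kmap_kinj kdiff_kinj oppr0 addrC kinjD.
Qed.

(* The variables form a regular sequence: multiplication by [x] is injective
   modulo the ideal generated by the variables in [xs]. *)
Lemma row_koszul_acyclic e a xs (u : koszul V xs) : uniq xs ->
  kin (row_deg e) a.+1 u -> kdiff mulX u = 0 ->
  exists2 t, kin (row_deg e.-1) a.+2 t & u = kdiff mulX t.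
Proof.
have degB e' := @row_inB (fun d => d.+1 = e').
have deg0 e' := @row_in0 (fun d => d.+1 = e').
elim: xs e a u => [|x xs IH] e a; first by move=> u _ /= ->; exists 0.
case=> u v /= /andP[xNxs uxs] [eu ev] [duv /eqP]; rewrite oppr_eq0 => /eqP dv.
have [w ew vE] : exists2 w, kin (row_deg e.-1) a.+1 w & v = kdiff mulX w.
  case: a eu ev => [|a] eu ev; last exact: IH.
  have {ev}[v0 ev0 vE] := kin_degree0 ev.
  rewrite {}vE kmap_kinj in duv *.
  (* The cycle condition says that [x] times [v0] is minus the differential of [u], hence lies in
     the submodule generated by [xs]; by regularity so does [v0]. *)
  apply: vanishing_kdiff1 => //; apply: (vanishing_mulX xNxs).
  have [v' v'E xv'] := kdiff1_vanishing eu.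
  have <- : - v' = mulX x v0.
    apply: (@kinj_inj _ _ xs).
    by apply/eqP; rewrite kinjN eqr_oppLR -addr_eq0 -v'E duv.
  by move=> c m m0; rewrite mxE mcoeffN xv' ?oppr0.
have [|||t et tE] := IH e a (u + kmap (mulX x) w).
- exact: uxs.
- apply: (kinD (deg0 e) (@degB e)) => //; apply: kin_kmap ew => v'.
  exact: row_deg_mulX.
- have dw : kmap (mulX x) v = kdiff mulX (kmap (mulX x) w).
    by rewrite vE; apply: kmap_kdiff => y v'; apply: mulXC.
  by rewrite raddfD /= -dw.
(* The sign of [w] cancels the summand [x w] added to [u] and the sign in the second component of
   [kdiff]. *)
exists (t, - w); first by split=> //; apply: (kinN (deg0 _) (@degB _)).
by rewrite /= -tE raddfN /= addrK raddfN opprK vE.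
Qed.
End FreeModule.
Arguments mulX {k n b} i.

(** * Betti numbers and Koszul homology of toric rings *)

Section ToricGrading.
Variables (k : fieldType) (G : sgraph).
Local Notation nV := #|{: vertex G}|.
Local Notation nE := #|edges G|.
Local Notation R := {mpoly k[nV]}.
Implicit Types (D : nat -> Prop) (f : R) (q : 'X_{1..nE}).

Definition edge_mnm (i : 'I_nE) : 'X_{1..nV} :=
  (\sum_(x in (enum_val i : {set G})) U_(enum_rank x))%MM.

Definition toric_mnm q : 'X_{1..nV} := (\sum_(i < nE) edge_mnm i *+ q i)%MM.

Lemma edge_monomialE i : edge_monomial k i = 'X_[edge_mnm i].
Proof. by rewrite /edge_monomial mprodXE. Qed.

Lemma toric_mapX q : toric_map ('X_[q] : {mpoly k[nE]}) = 'X_[toric_mnm q].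
Proof.
rewrite /toric_map comp_mpolyX -mprodXE; apply: eq_bigr => i _.
by rewrite tnth_mktuple edge_monomialE mpolyXn.
Qed.

Lemma toric_mnmD q1 q2 : toric_mnm (q1 + q2) = (toric_mnm q1 + toric_mnm q2)%MM.
Proof.
apply/mnmP => x; rewrite mnmDE !mnm_sumE -big_split /=.
by apply: eq_bigr => i _; rewrite !mulmnE mnmDE mulnDr.
Qed.

Lemma toric_mnmU i : toric_mnm U_(i) = edge_mnm i.
Proof.
apply/mnmP => x; rewrite mnm_sumE (bigD1 i) //= mulmnE mnm1E eqxx muln1 big1
  ?addn0 //.
by move=> j ji; rewrite mulmnE mnm1E eq_sym (negbTE ji) muln0.
Qed.

Lemma mdeg_edge_mnm i : mdeg (edge_mnm i) = 2.
Proof.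
have /imsetP[[x y] /= xy eE] := enum_valP i.
rewrite /edge_mnm mdeg_sum (eq_bigr (fun=> 1%N)) => [|z _]; last exact: mdeg1.
rewrite sum1_card eE cards2; case: eqP xy => // ->.
by rewrite inE /= adj_irrefl.
Qed.

Lemma mdeg_toric_mnm q : mdeg (toric_mnm q) = (2 * mdeg q)%N.
Proof.
rewrite mdeg_sum [X in (_ * X)%N]mdegE big_distrr /=.
by apply: eq_bigr => i _; rewrite mdegMn mdeg_edge_mnm.
Qed.

Definition toric_in D f :=
  forall m, f@_m != 0 -> exists2 q, m = toric_mnm q & D (mdeg q).

Definition toric_deg e := toric_in (fun d => d.+1 = e).

(** A monomial may be a product of edges in several ways, but the number of edges is always half its
    degree. *)
Lemma toric_in_disjoint D D' f :
  toric_in D f -> toric_in D' f -> (forall d, D d -> D' d -> False) -> f = 0.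
Proof.
move=> Df D'f DD'; apply/mpolyP => m; rewrite mcoeff0; apply/eqP.
apply: contraPT isT => /[dup] /Df[q -> Dq] /D'f[q' /(congr1 mdeg)].
rewrite !mdeg_toric_mnm => /eqP; rewrite eqn_pmul2l // => /eqP <-.
by move=> /(DD' _ Dq).
Qed.

Lemma toric_in0 D : toric_in D 0.
Proof. by move=> m; rewrite mcoeff0 eqxx. Qed.

Lemma toric_inB D f g : toric_in D f -> toric_in D g -> toric_in D (f - g).
Proof.
move=> Df Dg m; rewrite mcoeffB; have [->|/Dg //] := eqVneq (g@_m) 0.
by rewrite subr0 => /Df.
Qed.

Lemma toric_componentW d f : toric_component d f -> toric_in (eq^~ d) f.
Proof.
case=> p /dhomogP dp -> m; rewrite -mcoeff_msupp /toric_map comp_mpolyEX.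
move=> /msupp_sum_le/flattenP[s /mapP[q]]; rewrite mem_filter /= => qp ->
  /msuppZ_le.
by rewrite -/(toric_map _) toric_mapX msuppX inE => /eqP ->; exists q => //;
  apply: dp.
Qed.

Lemma toric_in_ring D f : toric_in D f -> toric_ring f.
Proof.
move=> Df.
have /choice[F FE] : forall m, exists p : {mpoly k[nE]}, f@_m *: 'X_[m] =
  toric_map p.
  move=> m; have [->|/Df[q -> _]] := eqVneq (f@_m) 0.
    by exists 0; rewrite scale0r /toric_map raddf0.
  exists (f@_(toric_mnm q) *: 'X_[q]).
  by rewrite -toric_mapX /toric_map comp_mpolyZ.
exists (\sum_(m <- msupp f) F m).
by rewrite {1}(mpolyE f) /toric_map raddf_sum; apply: eq_bigr.
Qed.

(** The action of an edge variable on all of k[V]; k[G] enters only through the predicates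
    [toric_deg]. *)
Definition mul_edge (i : 'I_nE) : {additive R -> R} :=
  GRing.mull_fun ('X_[edge_mnm i] : R) idfun.

End ToricGrading.
Arguments mul_edge k {G} i.

(** * Syzygies of the given resolution *)

Section Resolution.
Variables (k : fieldType) (G : sgraph) (F : min_graded_free_resolution k G).
Local Notation nV := #|{: vertex G}|.
Local Notation nE := #|edges G|.
Local Notation R := {mpoly k[nV]}.
Local Notation V i := 'rV[{mpoly k[nE]}]_(rk F i).

Definition aug_map (u : V 0) : R := (map_mx (@toric_map k G) u *m aug F) 0 0.

Lemma aug_mapE u : aug_map u = \sum_c toric_map (u 0 c) * aug F c 0.
Proof. by rewrite /aug_map mxE; apply: eq_bigr => c _; rewrite mxE. Qed.

Fact aug_map_is_zmod_morphism : zmod_morphism aug_map.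
Proof.
move=> u v; rewrite !aug_mapE -sumrB; apply: eq_bigr => c _.
by rewrite -mulrBl !mxE /toric_map raddfB.
Qed.

HB.instance Definition _ :=
  GRing.isZmodMorphism.Build (V 0) R aug_map aug_map_is_zmod_morphism.

Lemma aug_map_mulX i u : aug_map (mulX i u) = mul_edge k i (aug_map u).
Proof.
rewrite !aug_mapE /= big_distrr /=; apply: eq_bigr => c _.
by rewrite mxE /toric_map rmorphM /= -!/(toric_map _) toric_mapX toric_mnmU
  mulrA.
Qed.

Lemma aug_map_in D (u : V 0) :
  row_in (@deg _ _ F 0) D u -> toric_in D (aug_map u).
Proof.
move=> Du m; rewrite -mcoeff_msupp aug_mapE => /msupp_sum_le/flattenP[s /mapP[c
  _ ->]].
move=> /msuppM_le/allpairsP[[m1 m2] /= [m1u m2c ->]].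
have [q2 -> dq2] : exists2 q, m2 = toric_mnm q & mdeg q = deg c.
  by have /toric_componentW := aug_homogeneous c; apply; rewrite -mcoeff_msupp.
have [q1 -> q1u] : exists2 q, m1 = toric_mnm q & q \in msupp (u 0 c).
  move: m1u; rewrite /toric_map comp_mpolyEX => /msupp_sum_le/flattenP[s'
    /mapP[q]].
  rewrite mem_filter /= => qu -> /msuppZ_le.
  by rewrite -/(toric_map _) toric_mapX msuppX inE => /eqP ->; exists q.
exists (q1 + q2)%MM; first by rewrite toric_mnmD.
by rewrite mdegD dq2; apply: Du; rewrite -mcoeff_msupp.
Qed.

Lemma dif_in D i (u : V i.+1) :
  row_in (@deg _ _ F i.+1) D u -> row_in (@deg _ _ F i) D (u *m dif F i).
Proof.
move=> Du c m; rewrite -mcoeff_msupp mxE => /msupp_sum_le/flattenP[s /mapP[a _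
  ->]].
move=> /msuppM_le/allpairsP[[m1 m2] /= [m1u m2a ->]].
have := dif_homogeneous a c; rewrite mxE; case: ifP => [ca /dhomogP/(_ _ m2a)
  dm2|_ /eqP aE].
  rewrite mdegD dm2 -addnA subnK //; apply: Du; rewrite -mcoeff_msupp //.
by rewrite aE msupp0 in m2a.
Qed.

(** Keep the part of degree index [e] of any preimage. The error lies in that degree and, being the
    image of the other part, also outside it, so it is zero. *)
Lemma aug_map_lift e f : toric_deg e f ->
  exists2 v : V 0, row_deg (@deg _ _ F 0) e v & f = aug_map v.
Proof.
move=> ef; have [u uf] := aug_surjective F (toric_in_ring ef).
have [u1 [u2 [eu1 eu2 uE]]] := row_proj (@deg _ _ F 0) (fun d => d.+1 = e) u.
exists u1 => //; apply/eqP; rewrite -subr_eq0; apply/eqP.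
have e1 : toric_deg e (f - aug_map u1).
  by apply: toric_inB => //; apply: aug_map_in.
have e2 : toric_in (fun d => d.+1 <> e) (f - aug_map u1).
  by rewrite -uf -/(aug_map u) uE raddfD /= addrC addKr; apply: aug_map_in.
by apply: (toric_in_disjoint e1 e2).
Qed.

(** The kernel inside [F_i], that is, the syzygy module number [i.+1] of k[G]; hence the shifts by
    [i.+1] below. *)
Definition syz i : V i -> Prop :=
  match i with
  | 0 => fun u => aug_map u = 0
  | i'.+1 => fun u => u *m dif F i' = 0
  end.

Lemma syzP i (u : V i) : syz u <-> exists v, u = v *m dif F i.
Proof.
case: i u => [|i] u /=; last exact: exact_dif.
rewrite -exact_aug /aug_map; split=> [u0|->]; last by rewrite mxE.
by apply/matrixP => x y; rewrite !ord1 u0 mxE.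
Qed.

Definition syz_deg i e (u : V i) := row_deg (@deg _ _ F i) e u /\ syz u.

Lemma syz_lift i e u : syz_deg e u ->
  exists2 v : V i.+1, row_deg (@deg _ _ F i.+1) e v & u = v *m dif F i.
Proof.
case=> eu /syzP[v uE].
have [v1 [v2 [ev1 ev2 vE]]] := row_proj (@deg _ _ F i.+1) (fun d => d.+1 = e) v.
exists v1 => //; apply/eqP; rewrite -subr_eq0; apply/eqP.
have e1 : row_deg (@deg _ _ F i) e (u - v1 *m dif F i).
  by apply: row_inB => //; apply: dif_in.
have e2 : row_in (@deg _ _ F i) (fun d => d.+1 <> e) (u - v1 *m dif F i).
  by rewrite uE vE mulmxDl addrC addKr; apply: dif_in.
by apply: (row_in_disjoint e1 e2).
Qed.

(** Minimality enters here: a syzygy is an image of the next differential, whose entries have no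
    constant term. *)
Lemma syz_vanishing i (u : V i) xs :
  (forall j, j \in xs) -> syz u -> vanishing xs u.
Proof.
move=> xsT /syzP[v ->] c m m0.
have -> : m = 0%MM by apply/mnmP => j; rewrite m0 // mnm0E.
rewrite mxE raddf_sum big1 // => a _.
by rewrite /= rmorphM /= dif_minimal mulr0.
Qed.

Section Levels.
Variable xs : seq 'I_nE.
Hypotheses (xs_uniq : uniq xs) (xsT : forall j, j \in xs).

Local Notation HM := (koszul_homology_neq0 (mul_edge k) (@toric_deg k G) xs).
Local Notation HZ i := (koszul_homology_neq0 mulX (@syz_deg i) xs).

Let rowB i e := @row_inB k nE _ (@deg _ _ F i) (fun d => d.+1 = e).
Let row0 i e := @row_in0 k nE _ (@deg _ _ F i) (fun d => d.+1 = e).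
Let rowX i := @row_deg_mulX k nE _ (@deg _ _ F i).
Let acyc i e a (u : koszul (V i) xs) :
  kin (row_deg (@deg _ _ F i) e) a.+1 u -> kdiff mulX u = 0 ->
  exists2 t, kin (row_deg (@deg _ _ F i) e.-1) a.+2 t & u = kdiff mulX t.
Proof. exact: row_koszul_acyclic. Qed.
Let minim i e (v : V i) : syz_deg e v ->
  exists2 t : koszul (V i) xs, kin (row_deg (@deg _ _ F i) e.-1) 1 t &
    kinj xs v = kdiff mulX t.
Proof. by case=> ev /(syz_vanishing xsT); apply: vanishing_kdiff1. Qed.

Let aug_deg e u : row_deg (@deg _ _ F 0) e u -> toric_deg e (aug_map u).
Proof. exact: aug_map_in. Qed.

Let dif_deg i e u : row_deg (@deg _ _ F i.+1) e u ->
  @syz_deg i e (mulmxr (dif F i) u).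
Proof. by split; [apply: dif_in|apply/syzP; exists u]. Qed.

Let dif_mulX i x u : mulmxr (dif F i) (mulX x u) = mulX x (mulmxr (dif F i) u).
Proof. by rewrite /= -scalemxAl. Qed.

Lemma syz0_to_toric a e : HZ 0 a e -> HM a.+1 e.-1.
Proof.
by apply: (@koszul_homology_ker_to_im _ _ _ aug_map mulX (mul_edge k) _ _ xs
  (@mulXC _ _ _)
  aug_map_mulX (@row0 _) (@rowB _) (@rowX _) aug_deg aug_map_lift (@acyc _)
    (@minim 0)).
Qed.

Lemma toric_to_syz0 a e : HM a.+1 e -> HZ 0 a e.+1.
Proof.
by apply: (@koszul_homology_im_to_ker _ _ _ aug_map mulX (mul_edge k) _ _ xs
  (@mulXC _ _ _)
  aug_map_mulX (@row0 _) (@rowB _) (@rowX _) aug_deg aug_map_lift (@acyc _)).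
Qed.

Lemma syzS_to_syz i a e : HZ i.+1 a e -> HZ i a.+1 e.-1.
Proof.
by apply: (@koszul_homology_ker_to_im _ _ _ (mulmxr (dif F i)) mulX mulX _ _ xs
  (@mulXC _ _ _)
  (@dif_mulX i) (@row0 _) (@rowB _) (@rowX _) (@dif_deg i) (@syz_lift i) (@acyc
    _) (@minim i.+1)).
Qed.

Lemma syz_to_syzS i a e : HZ i a.+1 e -> HZ i.+1 a e.+1.
Proof.
by apply: (@koszul_homology_im_to_ker _ _ _ (mulmxr (dif F i)) mulX mulX _ _ xs
  (@mulXC _ _ _)
  (@dif_mulX i) (@row0 _) (@rowB _) (@rowX _) (@dif_deg i) (@syz_lift i) (@acyc
    _)).
Qed.
(** Each step towards k[G] raises the homological degree by one and lowers the coefficient degree by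
    one, so the total degree is kept. *)
Lemma syz_to_toric i a e : HZ i a e -> HM (a + i.+1) (e - i.+1).
Proof.
elim: i a e => [|i IH] a e; first by rewrite addn1 subn1; apply: syz0_to_toric.
by move=> /syzS_to_syz/IH; rewrite addSnnS -subn1 -subnDA.
Qed.

Lemma toric_to_syz i a e : HM (a + i.+1) e -> HZ i a (e + i.+1).
Proof.
elim: i a e => [|i IH] a e; first by rewrite !addn1; apply: toric_to_syz0.
by rewrite -addSnnS => /IH/syz_to_syzS; rewrite -addnS.
Qed.

(** Modulo all the variables, a free module is the vector space on its basis. *)
Lemma row_deg_not_boundary i e :
  (exists2 v : V i, row_deg (@deg _ _ F i) e v &
    forall t : koszul (V i) xs, kin (row_deg (@deg _ _ F i) e.-1) 1 t ->
    kinj xs v <> kdiff mulX t) <->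
  exists c, (@deg _ _ F i c).+1 = e.
Proof.
split=> [[v ev vNd]|[c ce]].
  apply: contrapT => cN.
  have xv : vanishing xs v.
    move=> c m m0; apply/eqP; apply: contraPT isT => /ev /= dc _.
    apply: cN; exists c; rewrite -dc.
    have -> : m = 0%MM by apply/mnmP => j; rewrite m0 // mnm0E.
    by rewrite mdeg0.
  have [t et] := vanishing_kdiff1 ev xv.
  exact: vNd.
exists (delta_mx 0 c) => [c' m|t].
  rewrite mxE eqxx /=; case: (c' =P c) => [->|_]; last by rewrite mcoeff0 eqxx.
  rewrite mcoeff1; case: (m =P 0%MM) => [->|]; last by rewrite eqxx.
  by rewrite mdeg0.
move=> /kdiff1_vanishing[v -> xv] /kinj_inj vE.
have := xv c 0%MM (fun j _ => mnm0E j).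
by rewrite -vE mxE !eqxx mcoeff1 eqxx => /eqP; rewrite oner_eq0.
Qed.

Lemma betti_koszul a j :
  betti F a j <> 0%N <-> exists2 e, j = (a + e)%N & HM a e.+1.
Proof.
have bettiE i : betti F i j <> 0%N <-> exists c, (@deg _ _ F i c).+1 = j.+1.
  rewrite /betti; split=> [/eqP|[c [cj]] /eqP].
    by rewrite cards_eq0 => /set0Pn[c]; rewrite inE => /eqP <-; exists c.
  by rewrite cards_eq0 => /eqP/setP/(_ c); rewrite !inE cj eqxx.
have im0 := @koszul_homology0_im _ _ _ aug_map mulX (mul_edge k) _ _ xs
  aug_map_mulX (@row0 _) (@rowB _) (@rowX _) aug_deg aug_map_lift (@minim 0).
have imS i := @koszul_homology0_im _ _ _ (mulmxr (dif F i)) mulX mulX _ _ xs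
  (@dif_mulX i) (@row0 _) (@rowB _) (@rowX _) (@dif_deg i) (@syz_lift i)
    (@minim i.+1).
case: a => [|i]; rewrite bettiE -row_deg_not_boundary.
  by rewrite -im0; split=> [H|[e -> ]//]; exists j.
rewrite -imS; split=> [/syz_to_toric|[e -> /(@toric_to_syz i 0)]]; last first.
  by rewrite addSn (addnC e).
rewrite add0n.
have [ij|ji] := leqP i.+1 j; first by rewrite subSn // => H;
  exists (j - i.+1)%N; rewrite ?subnKC.
(* Here [j <= i], so the index is truncated to 0, where all coefficients are zero and no class
   survives. *)
have -> : (j.+1 - i.+1 = 0)%N by apply/eqP; rewrite subn_eq0.
case=> z [Qz _ /(_ 0)[]]; first by apply: kin0; apply: toric_in0.
rewrite raddf0; apply: kin_eq0 Qz => f f0.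
by apply: (toric_in_disjoint f0 f0).
Qed.
End Levels.
End Resolution.

(** * Multigraded Koszul homology *)

(** Subtract from [z] its projection to the image and read off a nonzero coordinate of what remains,
    normalised to 1. *)
Lemma separating_functional (K : fieldType) (aT vT : vectType K)
    (f : 'Hom(aT, vT)) (z : vT) : (forall w, z <> f w) ->
  exists2 l : 'Hom(vT, K^o), forall w, l (f w) = 0 & l z = 1.
Proof.
move=> zNf; pose U := limg f.
have zNU : z \notin U by apply/negP => /memv_imgP[w _]; apply: zNf.
pose y := z - projv U z.
have yN0 : y != 0.
  by rewrite subr_eq0; apply: contraNneq zNU => ->; apply: memv_proj.
pose b := vbasis {: vT}.
have [i yi] : exists i, coord b i y != 0.
  apply: contrapT => yi; case/eqP: yN0.
  rewrite (coord_vbasis (memvf y)) big1 // => i _.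
  have [->|bi] := eqVneq (coord b i y) 0; first by rewrite scale0r.
  by case: yi; exists i.
pose c := linfun (coord b i : vT -> K^o).
exists ((coord b i y)^-1 *: (c \o (\1 - projv U)))%VF => [w|].
  rewrite scale_lfunE comp_lfunE lfunE /= add_lfunE opp_lfunE id_lfunE projv_id
    ?subrr ?linear0 ?scaler0 //.
  exact: memv_img (memvf w).
rewrite scale_lfunE comp_lfunE lfunE /= add_lfunE opp_lfunE id_lfunE -/y.
exact: mulVf.
Qed.

Section Multigraded.
Variables (k : fieldType) (n : nat) (S : pred 'X_{1..n}).
Implicit Types (h : 'X_{1..n}) (es : seq 'X_{1..n}).

(** Chains on all subsets of [r] vertices; the projections [sproj] cut the actual complexes out of
    it. As [r] is a plain number, [size_cat] and [size_map] can rewrite it without transporting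
    chains. *)
Fixpoint simplex (r : nat) : vectType k :=
  if r is r'.+1 then (simplex r' * simplex r')%type else k^o.

Fixpoint sdiff r : simplex r -> simplex r :=
  if r is r'.+1 return simplex r -> simplex r
  then fun u => (sdiff u.1 + u.2, - sdiff u.2) else fun=> 0.

Fixpoint sdegree (a r : nat) : simplex r -> simplex r :=
  if r is r'.+1 return simplex r -> simplex r
  then fun u => (sdegree a u.1, if a is a'.+1 then sdegree a' u.2 else 0)
  else fun u => if a is 0%N then u else 0.

(* Projection onto the faces [s], subsets of [es], such that [h - sum s] is in
   the semigroup [S]. *)
Fixpoint sproj es h r : simplex r -> simplex r :=
  if r is r'.+1 return simplex r -> simplex r
  then fun u => (sproj (behead es) h u.1,
    if (head 0%MM es <= h)%MM then sproj (behead es) (h - head 0%MM es)%MM u.2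
    else 0)
  else fun u => if S h then u else 0.

Fact sdiff_is_linear r : linear (@sdiff r).
Proof.
elim: r => [|r IH] c u v /=; first by rewrite scaler0 addr0.
rewrite !IH; congr (_, _) => /=; last by rewrite opprD scalerN.
by rewrite scalerDr addrACA.
Qed.
HB.instance Definition _ r :=
  GRing.isLinear.Build k (simplex r) (simplex r) *:%R (@sdiff r)
    (@sdiff_is_linear r).

Fact sdegree_is_linear a r : linear (@sdegree a r).
Proof.
elim: r a => [|r IH] [|a] c u v //=.
- by rewrite scaler0 addr0.
- by rewrite IH; congr (_, _) => /=; rewrite scaler0 addr0.
- by rewrite !IH.
Qed.
HB.instance Definition _ a r :=
  GRing.isLinear.Build k (simplex r) (simplex r) *:%R (@sdegree a r)
    (@sdegree_is_linear a r).

Fact sproj_is_linear es h r : linear (@sproj es h r).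
Proof.
elim: r es h => [|r IH] es h c u v /=.
  by case: (S h); rewrite // scaler0 addr0.
rewrite !IH; congr (_, _) => /=; case: ifP => // _.
by rewrite scaler0 addr0.
Qed.
HB.instance Definition _ es h r :=
  GRing.isLinear.Build k (simplex r) (simplex r) *:%R (@sproj es h r)
    (@sproj_is_linear es h r).

Lemma sdegree_id a r (u : simplex r) : sdegree a (sdegree a u) = sdegree a u.
Proof.
by elim: r a u => [|r IH] [|a] u //=; rewrite ?raddf0 ?IH.
Qed.

Lemma sdiff_degree0 r (u : simplex r) : sdiff (sdegree 0 u) = 0.
Proof. by elim: r u => [|r IH] u //=; rewrite IH !raddf0 addr0. Qed.

Lemma sdegree_sdiff a r (u : simplex r) :
  sdegree a (sdiff u) = sdiff (sdegree a.+1 u).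
Proof.
elim: r a u => [|r IH] a u; first by case: a.
rewrite /= raddfD /= IH; congr (_, _).
case: a => [|a]; first by rewrite sdiff_degree0 oppr0.
by rewrite raddfN /= IH.
Qed.

Lemma sproj_id es h r (u : simplex r) : sproj es h (sproj es h u) = sproj es h
  u.
Proof.
elim: r es h u => [|r IH] es h u /=; first by case: (S h).
by rewrite IH; case: (_ <= h)%MM; rewrite ?IH ?raddf0.
Qed.

Lemma sproj_sdegree es h a r (u : simplex r) :
  sproj es h (sdegree a u) = sdegree a (sproj es h u).
Proof.
elim: r es h a u => [|r IH] es h [|a] u /=.
- by [].
- by case: ifP.
- by rewrite IH; case: ifP; rewrite // raddf0.
- by rewrite !IH; case: ifP; rewrite ?IH ?raddf0.
Qed.

(* Some reduced homology class, of dimension [a - 1], of the simplicial complex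
   of the faces described at [sproj] does not vanish. *)
Definition face_homology_neq0 es h a r := exists z : simplex r,
  [/\ sproj es h z = z, sdegree a z = z, sdiff z = 0 &
      forall w, sproj es h w = w -> z <> sdiff w].

(** * Splitting Koszul chains into multidegrees *)

Section Components.
Variables (I : Type) (g : I -> 'X_{1..n}).
Local Notation R := {mpoly k[n]}.
Implicit Types xs : seq I.

Definition mulM (i : I) : {additive R -> R} :=
  GRing.mull_fun ('X_[g i] : R) idfun.

(** At a face [s] this is the coefficient of the monomial h - sum s, set to zero where the
    subtraction would truncate. *)
Fixpoint kcomp h xs : koszul R xs -> simplex (size xs) :=
  if xs is x :: xs' return koszul R xs -> simplex (size xs)
  then fun u => (kcomp h u.1,
    if (g x <= h)%MM then kcomp (h - g x)%MM u.2 else 0)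
  else fun u => u@_h.

(** Truncation is not tested here, so the lemmas on [kemb] ask for chains fixed by [sproj]. *)
Fixpoint kemb h xs : simplex (size xs) -> koszul R xs :=
  if xs is x :: xs' return simplex (size xs) -> koszul R xs
  then fun u => (kemb h u.1, kemb (h - g x)%MM u.2)
  else fun u => u *: 'X_[h].

Fact kcomp_is_zmod_morphism h xs : zmod_morphism (@kcomp h xs).
Proof.
elim: xs h => [|x xs IH] h u v /=; first exact: mcoeffB.
by rewrite !IH; congr (_, _) => /=; case: ifP; rewrite ?subr0.
Qed.
HB.instance Definition _ h xs :=
  GRing.isZmodMorphism.Build (koszul R xs) (simplex (size xs)) (@kcomp h xs)
    (@kcomp_is_zmod_morphism h xs).

Fact kemb_is_zmod_morphism h xs : zmod_morphism (@kemb h xs).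
Proof.
elim: xs h => [|x xs IH] h u v /=; first exact: scalerBl.
by rewrite !IH.
Qed.
HB.instance Definition _ h xs :=
  GRing.isZmodMorphism.Build (simplex (size xs)) (koszul R xs) (@kemb h xs)
    (@kemb_is_zmod_morphism h xs).

Lemma lem_subl (m1 m2 : 'X_{1..n}) h :
  (m1 <= h)%MM && (m2 <= h - m1)%MM = (m1 + m2 <= h)%MM.
Proof.
apply/andP/mnm_lepP => [[/mnm_lepP h1 /mnm_lepP h2] i|h12].
  by have := h2 i; rewrite mnmBE mnmDE leq_subRL.
split; apply/mnm_lepP => i; have := h12 i; rewrite mnmDE.
  exact: leq_trans (leq_addr _ _).
by rewrite mnmBE => h12i; rewrite leq_subRL // (leq_trans (leq_addr _ _) h12i).
Qed.

Lemma kcomp_mulM h x xs (u : koszul R xs) :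
  kcomp h (kmap (mulM x) u) =
    if (g x <= h)%MM then kcomp (h - g x)%MM u else 0.
Proof.
elim: xs h u => [|y xs IH] h u /=; first exact: mcoeffXM.
rewrite !IH; have := lem_subl (g x) (g y) h; rewrite addmC -lem_subl.
case: (g x <= h)%MM; case: (g y <= h)%MM => //= yx; rewrite ?yx -?yx //.
by case: ifP; rewrite // !submDA addmC.
Qed.

Lemma kcomp_kdiff h xs (u : koszul R xs) :
  kcomp h (kdiff mulM u) = sdiff (kcomp h u).
Proof.
elim: xs h u => [|x xs IH] h u /=; first exact: mcoeff0.
rewrite raddfD /= IH kcomp_mulM; congr (_, _).
by case: ifP => _; rewrite ?raddfN ?raddf0 ?oppr0 /= ?IH.
Qed.

Lemma mulM_kemb h x xs (u : simplex (size xs)) : (g x <= h)%MM ->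
  sproj (map g xs) (h - g x)%MM u = u ->
  kmap (mulM x) (kemb (h - g x)%MM u) = kemb h u.
Proof.
elim: xs h u => [|y xs IH] h u /= xh.
  by move=> _; rewrite /= -scalerAr -mpolyXD addmC submK.
case: u => u v /= [uE]; rewrite IH //.
case: ifP => [yh vE|_ <-]; last by rewrite !raddf0.
have hE : (h - g x - g y = h - g y - g x)%MM by rewrite !submDA addmC.
have xy : (g x <= h - g y)%MM.
  by have := lem_subl (g y) (g x) h; rewrite addmC -lem_subl xh yh => /andP[].
by rewrite hE in vE *; rewrite IH.
Qed.

Lemma kdiff_kemb h xs (u : simplex (size xs)) :
  sproj (map g xs) h u = u -> kdiff mulM (kemb h u) = kemb h (sdiff u).
Proof.
elim: xs h u => [|x xs IH] h u /=; first by rewrite scale0r.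
case: u => u v /= [uE]; case: ifP => [xh vE|_ <-]; last first.
  by rewrite !raddf0 ?oppr0 !addr0 IH.
by rewrite raddfD raddfN /= !IH // mulM_kemb.
Qed.

Lemma kcomp_inj xs (u v : koszul R xs) :
  (forall h, kcomp h u = kcomp h v) -> u = v.
Proof.
elim: xs u v => [|x xs IH] u v uv; first exact/mpolyP.
case: u v uv => [u1 u2] [v1 v2] uv; congr (_, _); apply: IH => h.
  by have [] := uv h.
(* At [h + g x] the divisibility test of [kcomp] succeeds and leaves the component at [h] of the
   faces containing [x]. *)
by have [_] := uv (h + g x)%MM; rewrite lem_addl addmK.
Qed.

Lemma kcomp_kemb h h' xs (u : simplex (size xs)) :
  sproj (map g xs) h u = u -> kcomp h' (kemb h u) = if h' == h then u else 0.
Proof.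
elim: xs h h' u => [|x xs IH] h h' u /=.
  move=> _; rewrite mcoeffZ mcoeffX eq_sym.
  by case: eqP; rewrite ?mulr1 ?mulr0.
case: u => u v /= [uE]; rewrite IH //; case: ifP => [xh vE|_ <-].
  rewrite IH //; have [->|hh'] := eqVneq h' h; first by rewrite xh eqxx.
  case: ifP => // xh'; case: eqP => // hE; case/eqP: hh'.
  by rewrite -(submK xh) -(submK xh') hE.
by rewrite !raddf0; case: (_ == _); case: ifP.
Qed.

Lemma kcomp_in h xs a (Q : R -> Prop) (u : koszul R xs) :
  (forall f, Q f -> forall m, f@_m != 0 -> S m) -> kin Q a u ->
  sproj (map g xs) h (kcomp h u) = kcomp h u /\
  sdegree a (kcomp h u) = kcomp h u.
Proof.
move=> QS; elim: xs a h u => [|x xs IH] [|a] h u /=.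
- move=> /QS uS; split=> //; case: ifP => // hS.
  by apply/esym/eqP; apply: contraFT hS => /uS.
- by move=> ->; rewrite mcoeff0; case: ifP.
- by case=> /IH{}IH ->; rewrite !(raddf0, if_same); case: (IH h) => -> ->.
- case=> /IH{}IH1 /IH{}IH2; case: (IH1 h) => -> ->.
  case: (g x <= h)%MM; last by rewrite raddf0.
  by case: (IH2 (h - g x)%MM) => -> ->.
Qed.

Hypothesis g2 : forall i, mdeg (g i) = 2.

Lemma kcomp_eq0 h xs a d (Q : R -> Prop) (u : koszul R xs) :
  (forall f, Q f -> forall m, f@_m != 0 -> mdeg m = d) -> kin Q a u ->
  mdeg h <> (d + 2 * a)%N -> kcomp h u = 0.
Proof.
move=> Qd; elim: xs a h u => [|x xs IH] [|a] h u /=.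
- rewrite muln0 addn0 => /Qd ud hd.
  by apply/eqP; apply/negPn/negP => /ud.
- by move=> ->; rewrite mcoeff0.
- by case=> /IH IH1 -> /IH1 ->; rewrite raddf0 if_same.
- case=> /IH IH1 /IH IH2 hd; rewrite IH1 //; case: ifP => // xh.
  rewrite IH2 // => hE; apply: hd.
  by rewrite -(submK xh) mdegD hE g2 mulnS addnA addnAC.
Qed.

Lemma kemb_in h xs a (u : simplex (size xs)) :
  sproj (map g xs) h u = u -> sdegree a u = u ->
  kin (fun f => forall m, f@_m != 0 -> S m /\ (mdeg m + 2 * a = mdeg h)%N)
    a (kemb h u).
Proof.
elim: xs a h u => [|x xs IH] [|a] h u /=.
- move=> uE _ m; rewrite mcoeffZ mcoeffX muln0 addn0.
  case: (eqVneq h m) => [<-|]; last by rewrite mulr0 eqxx.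
  by case: (S h) uE => // <-; rewrite mul0r eqxx.
- by move=> _ <-; rewrite scale0r.
- case: u => u v /= [uE _] [u0 <-]; rewrite raddf0; split=> //; exact: IH.
- case: u => u v /= [uE vE] [ua va]; split; first exact: IH.
  case: ifP vE => [xh vE|_ <-]; last first.
    by rewrite raddf0; apply: kin0 => m; rewrite mcoeff0 eqxx.
  apply: kin_imp (IH _ _ _ vE va) => f fE m /fE[-> mE]; split=> //.
  by rewrite -[in RHS](submK xh) mdegD -mE g2 mulnS addnA addnAC.
Qed.
(** A face of [a] edges dividing [h] already has degree [2 * a]; in smaller degree the cycle would
    be zero. *)
Lemma face_homology_degree h xs a :
  face_homology_neq0 (map g xs) h a (size xs) -> (2 * a <= mdeg h)%N.
Proof.
case=> z [Pz Dz _ zN]; rewrite leqNgt; apply/negP => ha.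
have kz0 : kemb h z = 0.
  apply: kin_eq0 (kemb_in Pz Dz) => f f0; apply/mpolyP => m; rewrite mcoeff0.
  apply/eqP; apply: contraLR ha => /f0[_ <-].
  by rewrite -leqNgt leq_addl.
apply: (zN 0); rewrite ?raddf0 //.
by have := kcomp_kemb h Pz; rewrite kz0 eqxx raddf0.
Qed.

Variable Q : nat -> R -> Prop.
Hypothesis QE : forall e f, Q e f <->
  forall m, f@_m != 0 -> S m /\ (mdeg m + 2 = 2 * e)%N.

Lemma koszul_homology_multigraded xs a e :
  koszul_homology_neq0 mulM Q xs a e.+1 <->
  exists2 h, mdeg h = (2 * (a + e))%N &
    face_homology_neq0 (map g xs) h a (size xs).
Proof.
have QS e' f : Q e' f -> forall m, f@_m != 0 -> S m.
  by move=> /QE + m => /(_ m) H /H[].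
split=> [[z [Qz dz0 zNd]]|[h hE [z [Pz Dz dz0 zNd]]]]; last first.
  exists (kemb h z); split=> [||t Qt zE].
  - apply: kin_imp (kemb_in Pz Dz) => f fE; apply/QE => m /fE[-> mE];
    split=> //.
    by rewrite mulnSr; congr (_ + _)%N; apply: (@addIn (2 * a));
      rewrite mE hE mulnDr addnC.
  - by rewrite kdiff_kemb // dz0 raddf0.
  have [Pt _] := kcomp_in h (QS _) Qt.
  apply: (zNd _ Pt); rewrite -kcomp_kdiff -zE kcomp_kemb // eqxx.
  by [].
apply: contrapT => hN.
have z0 h : mdeg h <> (2 * (a + e))%N -> kcomp h z = 0.
  move=> hE; apply: (@kcomp_eq0 _ _ _ (2 * e) (Q e.+1)) Qz _ => [f /QE fE m
    /fE[_]|].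
    by rewrite mulnSr => /addIn.
  by rewrite -mulnDr addnC.
(* If no face homology survives, every component of [z] bounds; bounding chains are chosen for all
   [h] at once, zero outside the relevant degree. *)
have /choice[w wE] : forall h, exists w : simplex (size xs),
    [/\ sproj (map g xs) h w = w, sdegree a.+1 w = w, kcomp h z = sdiff w &
        mdeg h = (2 * (a + e))%N \/ w = 0].
  move=> h; have [hE|/eqP hE] := eqVneq (mdeg h) (2 * (a + e))%N; last first.
    by exists 0; rewrite !raddf0 z0 //; split=> //; right.
  apply: contrapT => wN; apply: hN; exists h => //; exists (kcomp h z).
  have [Pz Dz] := kcomp_in h (QS _) Qz.
  split=> //; first by rewrite -kcomp_kdiff dz0 raddf0.
  (* The degree [a.+1] part of a bounding chain still bounds, as [sdiff] lowers the degree by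
     one. *)
  move=> w Pw zE; apply: wN; exists (sdegree a.+1 w).
  split; [by rewrite sproj_sdegree Pw|exact: sdegree_id| |by left].
  by rewrite -sdegree_sdiff -zE Dz.
(* Only multidegrees of degree [2 * (a + e)] contribute, so the finite sum over monomials of degree
   below [N] misses nothing. *)
pose N := (2 * (a + e)).+1.
have Q0 : Q e 0 by apply/QE => m; rewrite mcoeff0 eqxx.
have QB f f' : Q e f -> Q e f' -> Q e (f - f').
  move=> /QE fE /QE f'E; apply/QE => m; rewrite mcoeffB.
  by have [->|/f'E//] := eqVneq (f'@_m) 0; rewrite subr0 => /fE.
apply: (zNd (\sum_(h : 'X_{1..n < N}) kemb h (w h))).
  apply: (big_ind (fun t => kin (Q e) a.+1 t)) => [|t t'|h _].
  - exact: kin0.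
  - exact: kinD.
  have [Pw Dw _ [hE|->]] := wE h; last by rewrite raddf0; apply: kin0.
  apply: kin_imp (kemb_in Pw Dw) => f fE; apply/QE => m /fE[-> mE]; split=> //.
  apply: (@addIn (2 * a)); rewrite -mulnDr (addnC e) -hE -mE mulnSr.
  by rewrite addnAC addnA.
apply: kcomp_inj => h; rewrite kcomp_kdiff raddf_sum /=.
have sumE h' : kcomp h (kemb h' (w h')) = if h == h' then w h' else 0.
  by rewrite kcomp_kemb //; case: (wE h').
have [hN'|Nh] := ltnP (mdeg h) N.
  rewrite (bigD1 (BMultinom hN')) //= sumE eqxx big1 => [|h' h'N]; last first.
    by rewrite sumE; case: (h =P h') h'N => // hE; rewrite bmeqP /= -hE eqxx.
  by rewrite addr0; case: (wE h).
rewrite z0 => [|hE]; last by rewrite hE ltnn in Nh.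
rewrite big1 ?raddf0 // => h' _; rewrite sumE; case: eqP => // hE.
by rewrite hE leqNgt bmdeg in Nh.
Qed.
End Components.

(** * Tensor products of chains and their contraction *)

Fixpoint sprod r1 r2 : simplex r1 -> simplex r2 -> simplex (r1 + r2) :=
  if r1 is r1'.+1 return simplex r1 -> simplex r2 -> simplex (r1 + r2)
  then fun u w => (sprod u.1 w, sprod u.2 w) else fun u w => u *: w.

(** The identity tensored with [l]. *)
Fixpoint scontract r1 r2 (l : simplex r2 -> k^o) :
    simplex (r1 + r2) -> simplex r1 :=
  if r1 is r1'.+1 return simplex (r1 + r2) -> simplex r1
  then fun u => (scontract l u.1, scontract l u.2) else l.

Lemma sprodDl r1 r2 (u v : simplex r1) (w : simplex r2) :
  sprod (u + v) w = sprod u w + sprod v w.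
Proof.
by elim: r1 u v => [|r1 IH] u v /=; [rewrite scalerDl|rewrite !IH].
Qed.

Lemma sprodNl r1 r2 (u : simplex r1) (w : simplex r2) :
  sprod (- u) w = - sprod u w.
Proof. by elim: r1 u => [|r1 IH] u /=; [rewrite scaleNr|rewrite !IH]. Qed.

Lemma sprod0l r1 r2 (w : simplex r2) : sprod (0 : simplex r1) w = 0.
Proof. by elim: r1 => [|r1 IH] /=; [rewrite scale0r|rewrite !IH]. Qed.

(** The cycle condition on [w] removes the second term of the Leibniz rule, together with its
    sign. *)
Lemma sdiff_sprod r1 r2 (u : simplex r1) (w : simplex r2) :
  sdiff w = 0 -> sdiff (sprod u w) = sprod (sdiff u) w.
Proof.
move=> dw; elim: r1 u => [|r1 IH] u /=; first by rewrite linearZ /= dw scaler0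
  scale0r.
by rewrite !IH sprodDl sprodNl.
Qed.

Lemma sdegree_sprod a b r1 r2 (u : simplex r1) (w : simplex r2) :
  sdegree a u = u -> sdegree b w = w -> sdegree (a + b) (sprod u w) = sprod u w.
Proof.
move=> + bw; elim: r1 a u => [|r1 IH] [|a] u /=.
- by rewrite linearZ /= bw.
- by move=> <-; rewrite scale0r raddf0.
- case: u => u v /= [/IH -> <-]; rewrite sprod0l.
  by case: (0 + b)%N => // b'; rewrite raddf0.
- by case: u => u v /= [/IH -> /IH ->].
Qed.

Lemma scontract_sprod r1 r2 (l : 'Hom(simplex r2, k^o)) (u : simplex r1)
    (w : simplex r2) : l w = 1 -> scontract l (sprod u w) = u.
Proof.
move=> lw; elim: r1 u => [|r1 IH] u /=; last by case: u => u v; rewrite /= !IH.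
by rewrite linearZ /= lw; apply: mulr1.
Qed.

Lemma scontractD r1 r2 (l : 'Hom(simplex r2, k^o)) (u v : simplex (r1 + r2)) :
  scontract l (u + v) = scontract l u + scontract l v :> simplex r1.
Proof.
by elim: r1 u v => [|r1 IH] u v /=; [rewrite linearD|rewrite !IH].
Qed.

Lemma scontractN r1 r2 (l : 'Hom(simplex r2, k^o)) (u : simplex (r1 + r2)) :
  scontract l (- u) = - scontract l u :> simplex r1.
Proof.
by elim: r1 u => [|r1 IH] u /=; [rewrite linearN|rewrite !IH].
Qed.

Lemma scontract0 r1 r2 (l : 'Hom(simplex r2, k^o)) :
  scontract l 0 = 0 :> simplex r1.
Proof. by elim: r1 => [|r1 IH] /=; [rewrite linear0|rewrite !IH]. Qed.

(** * Joins *)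

Section Join.
Hypothesis SD : forall h1 h2, S h1 -> S h2 -> S (h1 + h2)%MM.

(** Makes the complex at [h1 + h2] the join of the complexes at [h1] and [h2]. Asking it of all
    smaller pairs makes it stable under subtraction of list elements, as the inductions on faces
    require. *)
Definition separated es1 es2 h1 h2 :=
  forall h1' h2', (h1' <= h1)%MM -> (h2' <= h2)%MM ->
  [/\ forall x, x \in es1 -> (x <= h1' + h2')%MM -> (x <= h1')%MM,
      forall x, x \in es2 -> (x <= h1' + h2')%MM -> (x <= h2')%MM &
      S (h1' + h2')%MM -> S h1' /\ S h2'].

Lemma separated_subr es1 es2 h1 h2 h :
  separated es1 es2 h1 h2 -> (h <= h2)%MM -> separated es1 es2 h1 h.
Proof.
move=> sep hh2 h1' h2' h1'h1 h2'h; apply: sep => //.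
exact: lepm_trans hh2.
Qed.

Lemma separated_subl es1 es2 h1 h2 h :
  separated es1 es2 h1 h2 -> (h <= h1)%MM -> separated es1 es2 h h2.
Proof.
move=> sep hh1 h1' h2' h1'h h2'h2; apply: sep => //.
exact: lepm_trans hh1.
Qed.

Lemma separated_consl x es1 es2 h1 h2 :
  separated (x :: es1) es2 h1 h2 -> separated es1 es2 h1 h2.
Proof.
move=> sep h1' h2' h1h h2h; have [H1 H2 H3] := sep _ _ h1h h2h.
by split=> // y y1; apply: H1; rewrite in_cons y1 orbT.
Qed.

Lemma separated_consr x es1 es2 h1 h2 :
  separated es1 (x :: es2) h1 h2 -> separated es1 es2 h1 h2.
Proof.
move=> sep h1' h2' h1h h2h; have [H1 H2 H3] := sep _ _ h1h h2h.
by split=> // y y2; apply: H2; rewrite in_cons y2 orbT.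
Qed.

Lemma lem_addrl h1 h2 x : (x <= h1)%MM -> (x <= h1 + h2)%MM.
Proof. by move=> xh; apply: lepm_trans xh (lem_addr _ _). Qed.

Lemma lem_addll h1 h2 x : (x <= h2)%MM -> (x <= h1 + h2)%MM.
Proof. by move=> xh; apply: lepm_trans xh (lem_addl _ _). Qed.

(** Any face of the complex at [h1 + h2] leaves a remainder in [S], whose separation gives [S h1];
    only the zero chain has no such face. *)
Lemma sproj_sep es1 es2 h1 h2 (w : simplex (size es2)) :
  separated es1 es2 h1 h2 -> sproj es2 (h1 + h2)%MM w = w ->
  sproj es2 h2 w = w /\ (S h1 \/ w = 0).
Proof.
elim: es2 h2 w => [|x es2 IH] h2 w sep /=.
  have [_ _ ] := sep h1 h2 (lepm_refl _) (lepm_refl _).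
  case: (S (h1 + h2)%MM) => [/(_ isT)[-> ->]|_ <-]; first by split=> //; left.
  by split; [case: ifP|right].
have sep' := separated_consr sep.
case: w => u v /= [/(IH _ _ sep')[-> u0]].
have [xh2|xNh2] := boolP (x <= h2)%MM.
  rewrite lem_addll // -addmBA // => /(IH _ _ (separated_subr sep' (lem_subr _
    _)))[-> v0].
  by split=> //; case: u0 => [|->]; [left|case: v0 => [|->]; [left|right]].
have [_ /(_ x (mem_head _ _)) H _] := sep h1 h2 (lepm_refl _) (lepm_refl _).
case: ifP => [/H|_ <-]; first by rewrite (negbTE xNh2).
by split=> //; case: u0 => [|->]; [left|right].
Qed.

Lemma sproj_add es1 es2 h1 h2 (w : simplex (size es2)) :
  separated es1 es2 h1 h2 -> S h1 -> sproj es2 h2 w = w ->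
  sproj es2 (h1 + h2)%MM w = w.
Proof.
elim: es2 h2 w => [|x es2 IH] h2 w sep Sh1 /=.
  by case: ifP => [/(SD Sh1) ->|_ <-] //; case: ifP.
have sep' := separated_consr sep.
case: w => u v /= [/(IH _ _ sep' Sh1) ->].
have [xh2|xNh2] := boolP (x <= h2)%MM.
  by rewrite lem_addll // -addmBA // => /(IH _ _ (separated_subr sep' (lem_subr
    _ _)) Sh1) ->.
by move=> <-; rewrite raddf0 if_same.
Qed.

Lemma sproj_sprod es1 es2 h1 h2 (u : simplex (size es1)) (w : simplex (size
  es2)) :
  separated es1 es2 h1 h2 -> sproj es1 h1 u = u -> sproj es2 h2 w = w ->
  sproj (es1 ++ es2) (h1 + h2)%MM (sprod u w) = sprod u w.
Proof.
move=> + + wE; elim: es1 h1 u => [|x es1 IH] h1 u sep /=.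
  rewrite linearZ /=; case: ifP => [Sh1 _|_ <-]; last by rewrite !scale0r.
  by rewrite (sproj_add sep).
have sep' := separated_consl sep.
case: u => u v /= [/(IH _ _ sep') ->].
have [xh1|xNh1] := boolP (x <= h1)%MM; last by move=> <-;
  rewrite sprod0l raddf0 if_same.
rewrite lem_addrl // => /(IH _ _ (separated_subl sep' (lem_subr _ _))).
by rewrite addmC addmBA // addmC => ->.
Qed.

(* A functional that kills the boundaries of the second factor turns a chain
   bounding a product of cycles into one bounding the first cycle. *)
Lemma sproj_scontract es1 es2 h1 h2 (l : 'Hom(simplex (size es2), k^o))
    (w : simplex (size es1 + size es2)) :
  separated es1 es2 h1 h2 -> sproj (es1 ++ es2) (h1 + h2)%MM w = w ->
  (forall w', sproj es2 h2 w' = w' -> l (sdiff w') = 0) ->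
  sproj es1 h1 (scontract l w) = scontract l w /\
  scontract l (sdiff w) = sdiff (scontract l w).
Proof.
move=> + + l0; elim: es1 h1 w => [|x es1 IH] h1 w sep /=.
  (* With [es1] exhausted the contraction is [l] itself, and [w] lives on the second complex, whose
     boundaries [l] kills. *)
  move=> /(sproj_sep sep)[/l0 -> Sh1]; split=> //.
  by case: Sh1 => [->//|->]; rewrite linear0 if_same.
have sep' := separated_consl sep.
case: w => u v /= [/(IH _ _ sep')[-> du]].
rewrite scontractD scontractN du.
have [xh1|xNh1] := boolP (x <= h1)%MM.
  rewrite lem_addrl // addmC -addmBA // addmC.
  by move=> /(IH _ _ (separated_subl sep' (lem_subr _ _)))[-> ->].
have [/(_ x (mem_head _ _)) H _ _] := sep h1 h2 (lepm_refl _) (lepm_refl _).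
case: ifP => [/H|_ <-]; first by rewrite (negbTE xNh1).
by rewrite !(raddf0, scontract0).
Qed.

Lemma face_homology_join es1 es2 h1 h2 a b :
  separated es1 es2 h1 h2 ->
  face_homology_neq0 es1 h1 a (size es1) ->
  face_homology_neq0 es2 h2 b (size es2) ->
  face_homology_neq0 (es1 ++ es2) (h1 + h2)%MM (a + b) (size (es1 ++ es2)).
Proof.
move=> sep [z1 [P1 D1 d1 N1]] [z2 [P2 D2 d2 N2]]; rewrite size_cat.
exists (sprod z1 z2); split.
- exact: sproj_sprod.
- exact: sdegree_sprod.
- by rewrite sdiff_sprod // d1 sprod0l.
(* Only boundaries of chains supported on the complex are to be killed, whence the composition with
   [sproj]. *)
have [w|l l0 l1] := @separating_functional _ _ _
    (linfun (@sdiff _) \o linfun (@sproj es2 h2 (size es2)))%VF z2.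
  by rewrite comp_lfunE !lfunE /=; apply: N2; apply: sproj_id.
have {}l0 w : sproj es2 h2 w = w -> l (sdiff w) = 0.
  by move=> Pw; have := l0 w; rewrite comp_lfunE !lfunE /= Pw.
(* If the product were [sdiff w], contraction would make [z1] the boundary of [scontract l w]. *)
move=> w Pw zE; have [Pc dc] := sproj_scontract sep Pw l0.
by apply: (N1 _ Pc); rewrite -dc -zE scontract_sprod.
Qed.
End Join.

(** The empty face is the only one, and it carries reduced homology in dimension -1. This starts the
    induction over components. *)
Lemma face_homology_disjoint es h :
  S h -> (forall x, x \in es -> ~~ (x <= h)%MM) ->
  face_homology_neq0 es h 0 (size es).
Proof.
move=> Sh esh.
have : exists z : simplex (size es),
    [/\ sproj es h z = z, sdegree 0 z = z, sdiff z = 0 & z <> 0].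
  elim: es esh => [|x es IH] esh /=.
    by exists 1; rewrite Sh; split=> //; apply/eqP/oner_neq0.
  have [|z [Pz Dz dz z0]] := IH; first by move=> y ye;
    rewrite esh // in_cons ye orbT.
  exists (z, 0) => /=; rewrite (negbTE (esh _ (mem_head _ _))) Pz Dz dz raddf0.
  by split=> //; [rewrite addr0 oppr0|case].
case=> z [Pz Dz dz z0]; exists z; split=> // w Pw zE; apply: z0; rewrite zE.
elim: es esh w Pw {Pz Dz dz z zE} => [//|x es IH] esh [u v] /= [Pu].
rewrite (negbTE (esh _ (mem_head _ _))) => <-.
rewrite IH ?raddf0 ?oppr0 ?addr0 // => y ye.
by rewrite esh // in_cons ye orbT.
Qed.
End Multigraded.

Lemma face_homology_transport (k : fieldType) n1 n2 (S1 : pred 'X_{1..n1})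
    (S2 : pred 'X_{1..n2}) (p : 'X_{1..n1} -> 'X_{1..n2}) es h a :
  (forall h, S2 (p h) = S1 h) -> (forall x h, (p x <= p h)%MM = (x <= h)%MM) ->
  (forall x h, p (h - x)%MM = (p h - p x)%MM) ->
  face_homology_neq0 k S1 es h a (size es) ->
  face_homology_neq0 k S2 (map p es) (p h) a (size (map p es)).
Proof.
move=> Sp lep pB; rewrite size_map.
have PE z : sproj S2 (map p es) (p h) z = sproj S1 es h z :> simplex k (size
  es).
  elim: es h z => [|x es IH] h z /=; first by rewrite Sp.
  by rewrite !IH lep -pB IH.
by case=> z [Pz Dz dz zN]; exists z; split=> // [|w]; rewrite PE //; apply: zN.
Qed.

(** * Disjoint induced subgraphs *)

Section ToricSemigroup.
Variables (k : fieldType) (G : sgraph).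
Local Notation nE := #|edges G|.

Definition toric_semigroup : pred 'X_{1..#|{: vertex G}|} :=
  fun h => `[< exists q : 'X_{1..nE}, h = toric_mnm q >].

Lemma toric_semigroupP h :
  reflect (exists q : 'X_{1..nE}, h = toric_mnm q) (toric_semigroup h).
Proof. exact: asboolP. Qed.

Lemma toric_mnm0 : toric_mnm 0 = 0%MM :> 'X_{1..#|{: vertex G}|}.
Proof. by apply/eqP; rewrite -mdeg_eq0 mdeg_toric_mnm mdeg0. Qed.

Lemma toric_semigroup0 : toric_semigroup 0%MM.
Proof. by apply/toric_semigroupP; exists 0%MM; rewrite toric_mnm0. Qed.

Lemma toric_semigroup_edge (i : 'I_nE) : toric_semigroup (edge_mnm i).
Proof. by apply/toric_semigroupP; exists U_(i)%MM; rewrite toric_mnmU. Qed.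

Lemma toric_semigroupD h1 h2 :
  toric_semigroup h1 -> toric_semigroup h2 -> toric_semigroup (h1 + h2)%MM.
Proof.
move=> /toric_semigroupP[q1 ->] /toric_semigroupP[q2 ->].
by apply/toric_semigroupP; exists (q1 + q2)%MM; rewrite toric_mnmD.
Qed.

Lemma toric_semigroup_ind (P : 'X_{1..#|{: vertex G}|} -> Prop) :
  P 0%MM ->
  (forall i h, toric_semigroup h -> P h -> P (edge_mnm i + h)%MM) ->
  forall h, toric_semigroup h -> P h.
Proof.
move=> P0 PD h /toric_semigroupP[q ->].
have [d] := ubnP (mdeg q); elim: d q => // d IH q dq.
have [->|q0] := eqVneq q 0%MM; first by rewrite toric_mnm0.
have [i qi] : exists i, q i != 0%N.
  apply: contrapT => qN; case/eqP: q0; apply/mnmP => i; rewrite mnm0E.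
  by apply/eqP; apply: contrapT => /negP qi; apply: qN; exists i.
rewrite -lep1mP in qi; have qE := submK qi; rewrite -qE mdegD mdeg1 addn1 ltnS
  in dq.
rewrite -qE addmC toric_mnmD toric_mnmU.
by apply: PD; [apply/toric_semigroupP; eexists|apply: IH].
Qed.

Lemma edge_mnmE (i : 'I_nE) (v : G) :
  edge_mnm i (enum_rank v) = (v \in (enum_val i : {set G})).
Proof.
rewrite /edge_mnm mnm_sumE.
have [vi|vNi] := boolP (v \in (enum_val i : {set G})).
  rewrite (bigD1 v) //= mnm1E eqxx big1 // => w /andP[_ wv].
  by rewrite mnm1E (inj_eq enum_rank_inj) (negbTE wv).
rewrite big1 // => w wi; rewrite mnm1E (inj_eq enum_rank_inj).
by case: eqP vNi => // <-; rewrite wi.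
Qed.

Lemma edge_mnm_inj : injective (@edge_mnm G).
Proof.
by move=> i j ij; apply/enum_val_inj/setP => v;
  rewrite -[LHS]lt0b -[RHS]lt0b -!edge_mnmE ij.
Qed.

(** The enumeration [xs] is arbitrary, so that edges can later be listed component by component. *)
Lemma betti_face (F : min_graded_free_resolution k G) (xs : seq 'I_nE) a j :
  uniq xs -> (forall i, i \in xs) ->
  betti F a j <> 0%N <->
  exists2 h, mdeg h = (2 * j)%N &
    face_homology_neq0 k toric_semigroup (map (@edge_mnm G) xs) h a (size xs).
Proof.
move=> xs_uniq xsT; rewrite (betti_koszul F xs_uniq xsT).
have QE e (f : {mpoly k[#|{: vertex G}|]}) : toric_deg e f <->
    forall m, f@_m != 0 -> toric_semigroup m /\ (mdeg m + 2 = 2 * e)%N.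
  split=> fE m /fE; last first.
    case=> /toric_semigroupP[q ->]; rewrite mdeg_toric_mnm -mulnSr => /eqP.
    by rewrite eqn_pmul2l // => /eqP; exists q.
  by case=> q -> <-; rewrite mdeg_toric_mnm -mulnSr; split=> //;
    apply/toric_semigroupP; exists q.
have H e := @koszul_homology_multigraded k _ toric_semigroup _ (@edge_mnm G)
  (@mdeg_edge_mnm G) (@toric_deg k G) QE xs a e.
split=> [[e -> /H]//|[h hE hF]].
have aj : (a <= j)%N.
  by have := face_homology_degree (@mdeg_edge_mnm G) hF; rewrite hE leq_pmul2l.
by exists (j - a)%N; rewrite ?subnKC //; apply/H; exists h; rewrite ?subnKC.
Qed.
End ToricSemigroup.

Lemma rank_mnmP (T : finType) (m1 m2 : 'X_{1..#|{: T}|}) :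
  (forall v : T, m1 (enum_rank v) = m2 (enum_rank v)) -> m1 = m2.
Proof. by move=> m12; apply/mnmP => i; rewrite -(enum_valK i). Qed.

Lemma rank_mnm_lepP (T : finType) (m1 m2 : 'X_{1..#|{: T}|}) :
  reflect (forall v : T, m1 (enum_rank v) <= m2 (enum_rank v))%N (m1 <= m2)%MM.
Proof.
apply: (iffP mnm_lepP) => m12 i; first exact: m12.
by rewrite -(enum_valK i).
Qed.

(** * Extension of multidegrees by zero *)

Section Push.
Variables (T1 T2 : finType) (phi : T1 -> T2).
Hypothesis phi_inj : injective phi.
Implicit Types h : 'X_{1..#|{: T1}|}.

Definition mpush h : 'X_{1..#|{: T2}|} :=
  (\sum_(x : T1) U_(enum_rank (phi x)) *+ h (enum_rank x))%MM.

Lemma mpushE h x : mpush h (enum_rank (phi x)) = h (enum_rank x).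
Proof.
rewrite mnm_sumE (bigD1 x) //= mulmnE mnm1E eqxx mul1n big1 ?addn0 // => y yx.
by rewrite mulmnE mnm1E (inj_eq enum_rank_inj) (inj_eq phi_inj) (negbTE yx).
Qed.

Lemma mpush_out h v : v \notin codom phi -> mpush h (enum_rank v) = 0%N.
Proof.
move=> vN; rewrite mnm_sumE big1 // => x _; rewrite mulmnE mnm1E.
by rewrite (inj_eq enum_rank_inj); case: eqP vN => // <-; rewrite codom_f.
Qed.

Lemma mpush_le h1 h2 : (mpush h1 <= mpush h2)%MM = (h1 <= h2)%MM.
Proof.
apply/rank_mnm_lepP/rank_mnm_lepP => h12 v; first by rewrite -!mpushE.
have [/codomP[x ->]|vN] := boolP (v \in codom phi); first by rewrite !mpushE.
by rewrite !mpush_out.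
Qed.

Lemma mpushB h1 h2 : mpush (h1 - h2) = (mpush h1 - mpush h2)%MM.
Proof.
apply: rank_mnmP => v; rewrite mnmBE.
have [/codomP[x ->]|vN] := boolP (v \in codom phi);
  first by rewrite !mpushE mnmBE.
by rewrite !mpush_out.
Qed.

Lemma mpushD h1 h2 : mpush (h1 + h2) = (mpush h1 + mpush h2)%MM.
Proof.
apply: rank_mnmP => v; rewrite mnmDE.
have [/codomP[x ->]|vN] := boolP (v \in codom phi);
  first by rewrite !mpushE mnmDE.
by rewrite !mpush_out.
Qed.

Lemma mpush_inj : injective mpush.
Proof. by move=> h1 h2 h12; apply: rank_mnmP => v; rewrite -!mpushE h12. Qed.

Lemma mpush0 : mpush 0 = 0%MM.
Proof. by rewrite /mpush big1 // => x _; rewrite mnm0E mulm0n. Qed.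

Lemma mdeg_mpush h : mdeg (mpush h) = mdeg h.
Proof.
rewrite mdeg_sum mdegE (reindex (@enum_rank T1)) /=; last first.
  by apply: onW_bij; apply: enum_rank_bij.
by apply: eq_bigr => x _; rewrite mdegMn mdeg1 mul1n.
Qed.
End Push.

Lemma edgeP (G : sgraph) (i : 'I_#|edges G|) :
  exists x y : G, adj x y /\ enum_val i = [set x; y].
Proof.
have /imsetP[[x y] /= xy ->] := enum_valP i.
by exists x, y; rewrite inE in xy.
Qed.

Lemma edge_index (G : sgraph) (x y : G) :
  adj x y -> exists i : 'I_#|edges G|, enum_val i = [set x; y].
Proof.
move=> xy; have xyE : [set x; y] \in edges G by apply/imsetP; exists (x, y);
  rewrite ?inE.
by exists (enum_rank_in xyE [set x; y]); rewrite enum_rankK_in.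
Qed.

Lemma edge_mnm_le (G : sgraph) (i : 'I_#|edges G|) (h : 'X_{1..#|{: vertex
  G}|}) :
  reflect (forall v, v \in (enum_val i : {set G}) -> 0 < h (enum_rank v))%N
    (edge_mnm i <= h)%MM.
Proof.
apply: (iffP (rank_mnm_lepP _ _)) => ih v; last first.
  by rewrite edge_mnmE; case: (boolP (v \in _)) => // /ih.
by have := ih v; rewrite edge_mnmE => /[swap] ->.
Qed.

Section DisjointSubgraphs.
Variables (k : fieldType) (G : sgraph) (s : nat) (H : 'I_s -> sgraph).
Variable phi : {i : 'I_s & H i} -> G.
Hypothesis phi_inj : injective phi.
Hypothesis phi_adj : forall x y, adj (phi x) (phi y) = disjoint_union_adj x y.

Let phi_ i (x : H i) : G := phi (Tagged (fun i => vertex (H i)) x).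

Let phi__inj i : injective (@phi_ i).
Proof. by move=> x y /phi_inj; apply: eq_from_Tagged. Qed.

Let phi__adj i x y : adj (@phi_ i x) (@phi_ i y) = adj x y.
Proof. by rewrite phi_adj /disjoint_union_adj /= eqxx tagged_asE. Qed.

Let phi__adj_tag i j x y : adj (@phi_ i x) (@phi_ j y) -> i = j.
Proof. by rewrite phi_adj => /andP[/eqP]. Qed.

Let push i := mpush (@phi_ i).
Arguments push : clear implicits.

Lemma edge_embedding i (e : 'I_#|edges (H i)|) :
  exists e' : 'I_#|edges G|, edge_mnm e' = push i (edge_mnm e).
Proof.
have [x [y [xy eE]]] := edgeP e.
have [|e' e'E] := @edge_index G (phi_ x) (phi_ y); first by rewrite phi__adj.
exists e'; apply: rank_mnmP => v; rewrite edge_mnmE e'E.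
have [/codomP[z ->]|vN] := boolP (v \in codom (@phi_ i)).
  rewrite /push mpushE; last exact: phi__inj.
  by rewrite edge_mnmE eE !inE !(inj_eq (@phi__inj i)).
by rewrite /push mpush_out //; case: set2P vN => // -[->|->]; rewrite codom_f.
Qed.

(** Inducedness enters here: both ends of such an edge lie in the image of [H i], so it is already
    an edge of [H i]. *)
Lemma edge_in_component i (e : 'I_#|edges G|) h :
  (edge_mnm e <= push i h)%MM -> exists e' : 'I_#|edges (H i)|, edge_mnm e =
    push i (edge_mnm e').
Proof.
move=> /edge_mnm_le eh; have [u [v [uv eE]]] := edgeP e.
have in_codom w : w \in (enum_val e : {set G}) -> w \in codom (@phi_ i).
  by move=> /eh; apply: contraTT => wN; rewrite /push mpush_out.
have /codomP[x xE] : u \in codom (@phi_ i) by apply: in_codom; rewrite eE set21.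
have /codomP[y yE] : v \in codom (@phi_ i) by apply: in_codom; rewrite eE set22.
have [|e' e'E] := @edge_index (H i) x y; first by rewrite -phi__adj -xE -yE.
exists e'; apply: rank_mnmP => w; rewrite edge_mnmE eE xE yE.
have [/codomP[z ->]|wN] := boolP (w \in codom (@phi_ i)).
  rewrite /push mpushE; last exact: phi__inj.
  by rewrite edge_mnmE e'E !inE !(inj_eq (@phi__inj i)).
by rewrite /push mpush_out //; case: set2P wN => // -[->|->]; rewrite codom_f.
Qed.

Lemma toric_semigroup_push i h :
  toric_semigroup (push i h) = toric_semigroup h.
Proof.
apply/idP/idP; last first.
  move: h; apply: (toric_semigroup_ind
    (P := fun h => is_true (toric_semigroup (push i h)))) => [|e h _ IH].
    by rewrite /push mpush0 toric_semigroup0.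
  have [e' e'E] := edge_embedding e.
  rewrite /push mpushD // -/(push i _) -e'E.
  by apply: toric_semigroupD => //; apply: toric_semigroup_edge.
(* The induction strips edges of [G], so the preimage [h'] must vary along with [g]. *)
suff semi g : toric_semigroup g ->
    forall h', push i h' = g -> toric_semigroup h' by move=> /semi; apply.
move: g; apply: toric_semigroup_ind => [h'|e g _ IH h' hE].
  rewrite -(mpush0 (@phi_ i)) => /(mpush_inj (@phi__inj i)) ->.
  exact: toric_semigroup0.
have [|e' e'E] := @edge_in_component i e h'; first by rewrite hE lem_addr.
have e'h : (edge_mnm e' <= h')%MM.
  by rewrite -(mpush_le (@phi__inj i)) -/(push i _) -e'E -/(push i _) hE
    lem_addr.
rewrite -(submK e'h) addmC.
apply: toric_semigroupD; first exact: toric_semigroup_edge.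
apply: IH; rewrite /push mpushB // -?/(push i _) -e'E hE.
by rewrite addmC addmK.
Qed.
Let eps i : 'I_#|edges (H i)| -> 'I_#|edges G| :=
  projT1 (choice (@edge_embedding i)).
Arguments eps : clear implicits.

Let epsE i e : edge_mnm (eps i e) = push i (edge_mnm e).
Proof. exact: (projT2 (choice (@edge_embedding i))). Qed.

Definition component_edges i := [seq eps i e | e <- enum 'I_#|edges (H i)|].

Lemma component_edgesP i e : reflect
  (exists e', edge_mnm e = push i (edge_mnm e')) (e \in component_edges i).
Proof.
apply: (iffP mapP) => [[e' _ ->]|[e' eE]]; exists e'; rewrite ?mem_enum //.
by apply: (@edge_mnm_inj G); rewrite epsE.
Qed.

Lemma component_edges_uniq i : uniq (component_edges i).
Proof.
rewrite map_inj_uniq ?enum_uniq // => e e' /(congr1 (@edge_mnm G)).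
by rewrite !epsE => /(mpush_inj (@phi__inj i))/edge_mnm_inj.
Qed.

Lemma component_edges_codom i e v :
  e \in component_edges i -> v \in (enum_val e : {set G}) ->
  v \in codom (@phi_ i).
Proof.
move=> /component_edgesP[e' eE]; rewrite -[v \in enum_val e]lt0b -edge_mnmE eE.
by apply: contraTT => vN; rewrite /push mpush_out.
Qed.

Lemma codom_disjoint i j v :
  v \in codom (@phi_ i) -> v \in codom (@phi_ j) -> i = j.
Proof. by move=> /codomP[x ->] /codomP[y /phi_inj[]]. Qed.

Lemma component_edges_disjoint i j e :
  e \in component_edges i -> e \in component_edges j -> i = j.
Proof.
have [u [v [_ eE]]] := edgeP e.
have ue : u \in (enum_val e : {set G}) by rewrite eE set21.
move=> /component_edges_codom/(_ ue) ui /component_edges_codom/(_ ue).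
exact: codom_disjoint.
Qed.

(** These divide no multidegree supported on the image of [phi], yet they are variables of k[E] and
    must be enumerated. *)
Definition other_edges :=
  [seq e <- enum 'I_#|edges G| | [forall i, e \notin component_edges i]].

Definition component_list r := flatten [seq component_edges i | i <- r].

Lemma component_listP r e : reflect
  (exists2 i, i \in r & e \in component_edges i) (e \in component_list r).
Proof. exact: flatten_mapP. Qed.

Lemma component_list_uniq r : uniq r -> uniq (component_list r).
Proof.
elim: r => //= i r IH /andP[iNr /IH ur].
rewrite /component_list /= cat_uniq component_edges_uniq -/(component_list r)
  ur andbT /=.
apply/hasPn => e /component_listP[j jr ej]; apply: contra iNr => ei.
by rewrite (component_edges_disjoint ei ej).
Qed.

Section Separation.
Variables (i : 'I_s) (r : seq 'I_s) (h : forall j, 'X_{1..#|{: vertex (H j)}|}).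
Hypothesis iNr : i \notin r.
Local Notation h2 := (\sum_(j <- r) push j (h j))%MM.
Variables (h1' h2' : 'X_{1..#|{: vertex G}|}).
Hypotheses (h1le : (h1' <= push i (h i))%MM) (h2le : (h2' <= h2)%MM).

Let supp1 v : (0 < h1' (enum_rank v))%N -> v \in codom (@phi_ i).
Proof.
move=> h1v; have {h1v} : (0 < push i (h i) (enum_rank v))%N.
  by apply: leq_trans h1v _; apply/mnm_lepP.
by apply: contraTT => vN; rewrite /push mpush_out.
Qed.

Let supp2 v : (0 < h2' (enum_rank v))%N ->
  exists2 j, j \in r & v \in codom (@phi_ j).
Proof.
move=> h2v; have {h2v} : (0 < h2 (enum_rank v))%N.
  by apply: leq_trans h2v _; apply/mnm_lepP.
rewrite mnm_sumE; apply: contraPP => vN.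
rewrite big_seq big1 // => j jr; rewrite /push mpush_out //.
by apply/negP => vj; apply: vN; exists j.
Qed.

Let supp2N v : v \in codom (@phi_ i) -> h2' (enum_rank v) = 0%N.
Proof.
move=> vi; apply/eqP; rewrite eqn0Ngt; apply/negP => /supp2[j jr vj].
by move: iNr; rewrite (codom_disjoint vi vj) jr.
Qed.

(** Both ends lie in components, and adjacent vertices lie in the same one, so the edge meets the
    support of only one summand. *)
Lemma edge_le_sum e : (edge_mnm e <= h1' + h2')%MM ->
  (forall v, v \in (enum_val e : {set G}) -> v \in codom (@phi_ i)) /\
    (edge_mnm e <= h1')%MM \/
  (forall v, v \in (enum_val e : {set G}) -> v \notin codom (@phi_ i)) /\
    (edge_mnm e <= h2')%MM.
Proof.
move=> /edge_mnm_le eh; have [u [v [uv eE]]] := edgeP e.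
have supp w : w \in (enum_val e : {set G}) -> exists j, w \in codom (@phi_ j).
  move=> /eh; rewrite mnmDE addn_gt0 => /orP[/supp1 wi|/supp2[j _ wj]].
    by exists i.
  by exists j.
have nbr w w' : w \in (enum_val e : {set G}) -> adj w' w ->
    w' \in codom (@phi_ i) -> w \in codom (@phi_ i).
  move=> /supp[j /codomP[y ->]] + /codomP[x w'E];
    rewrite w'E => /phi__adj_tag ij.
  by case: j / ij y => y; apply: codom_f.
have [ue ve] : u \in (enum_val e : {set G}) /\ v \in (enum_val e : {set G}).
  by rewrite eE set21 set22.
have [ui|uNi] := boolP (u \in codom (@phi_ i)); [left|right].
  have ei w : w \in (enum_val e : {set G}) -> w \in codom (@phi_ i).
    by rewrite eE => /set2P[->//|->]; apply: nbr uv ui.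
  split=> //; apply/edge_mnm_le => w we; have := eh w we.
  by rewrite mnmDE supp2N ?addn0 //; apply: ei.
have eNi w : w \in (enum_val e : {set G}) -> w \notin codom (@phi_ i).
  rewrite eE => /set2P[->//|->]; apply: contra uNi; apply: nbr => //.
  by rewrite adj_sym.
split=> //; apply/edge_mnm_le => w we; have := eh w we.
rewrite mnmDE addn_gt0 => /orP[/supp1|//].
by rewrite (negbTE (eNi w we)).
Qed.

Let in_component e : (edge_mnm e <= h1')%MM -> e \in component_edges i.
Proof.
move=> eh1; have [|e' e'E] := @edge_in_component i e (h i).
  exact: lepm_trans h1le.
by apply/component_edgesP; exists e'.
Qed.

Lemma component_edge_le x : x \in map (@edge_mnm G) (component_edges i) ->
  (x <= h1' + h2')%MM -> (x <= h1')%MM.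
Proof.
case/mapP=> e ei -> /edge_le_sum[[]//|[eN _]].
have [u [v [_ eE]]] := edgeP e.
have ue : u \in (enum_val e : {set G}) by rewrite eE set21.
by have := eN u ue; rewrite (component_edges_codom ei ue).
Qed.

Lemma other_component_edge_le x : x \in map (@edge_mnm G) (component_list r ++
  other_edges) ->
  (x <= h1' + h2')%MM -> (x <= h2')%MM.
Proof.
case/mapP=> e eS -> /edge_le_sum[[_ /in_component ei]|[]//].
move: eS; rewrite mem_cat mem_filter => /orP[/component_listP[j jr ej]|].
  by move: iNr; rewrite (component_edges_disjoint ei ej) jr.
by case/andP=> /forallP/(_ i); rewrite ei.
Qed.
End Separation.

Lemma toric_semigroup_separated i r h : i \notin r ->
  separated (@toric_semigroup G) (map (@edge_mnm G) (component_edges i))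
    (map (@edge_mnm G) (component_list r ++ other_edges))
    (push i (h i)) (\sum_(j <- r) push j (h j))%MM.
Proof.
move=> iNr h1' h2' h1le h2le; split.
- by move=> x; apply: (component_edge_le (h := h) iNr h1le h2le).
- by move=> x; apply: (other_component_edge_le (h := h) iNr h1le h2le).
(* Generalised to all pairs of summands: each step takes one edge off the summand in which it
   lies. *)
move=> S12; suff semi g : toric_semigroup g -> forall h1'' h2'',
    (h1'' <= push i (h i))%MM -> (h2'' <= \sum_(j <- r) push j (h j))%MM ->
    (h1'' + h2'')%MM = g -> toric_semigroup h1'' /\ toric_semigroup h2''.
  exact: semi S12 _ _ h1le h2le _.
move: g; apply: toric_semigroup_ind => [g1 g2 _ _ /eqP|e g _ IH g1 g2 g1le g2le
  gE].
  by rewrite mnmD_eq0 => /andP[/eqP-> /eqP->]; rewrite toric_semigroup0.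
have : (edge_mnm e <= g1 + g2)%MM by rewrite gE lem_addr.
case/(edge_le_sum (h := h) iNr g1le g2le) => -[_ eg].
  have [||S1 S2] := IH (g1 - edge_mnm e)%MM g2 _ g2le.
  - exact: lepm_trans (lem_subr _ _) g1le.
  - by apply: (@addmI _ (edge_mnm e)); rewrite addmA -gE (addmC (edge_mnm e))
    submK.
  by split=> //; rewrite -(submK eg); apply: toric_semigroupD S1
    (toric_semigroup_edge e).
have [||S1 S2] := IH g1 (g2 - edge_mnm e)%MM g1le.
- exact: lepm_trans (lem_subr _ _) g2le.
- by apply: (@addIm _ (edge_mnm e)); rewrite -addmA submK // gE addmC.
by split=> //; rewrite -(submK eg); apply: toric_semigroupD S2
  (toric_semigroup_edge e).
Qed.

Lemma face_homology_components r (h : forall j, 'X_{1..#|{: vertex (H j)}|}) a :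
  uniq r ->
  (forall i, face_homology_neq0 k (@toric_semigroup (H i))
     (map (@edge_mnm (H i)) (enum 'I_#|edges (H i)|)) (h i) (a i)
     (size (enum 'I_#|edges (H i)|))) ->
  face_homology_neq0 k (@toric_semigroup G)
    (map (@edge_mnm G) (component_list r ++ other_edges))
    (\sum_(i <- r) push i (h i))%MM (\sum_(i <- r) a i)
    (size (component_list r ++ other_edges)).
Proof.
move=> + hF; rewrite -(size_map (@edge_mnm G)).
elim: r => [|i r IH] /= => [_|/andP[iNr /IH{}IH]].
  (* With no component left the multidegree is 0, which no edge divides. *)
  rewrite !big_nil; apply: face_homology_disjoint;
    first exact: toric_semigroup0.
  move=> _ /mapP[e _ ->]; apply/negP => /edge_mnm_le e0.
  have [u [v [_ eE]]] := edgeP e.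
  by have := e0 u; rewrite eE set21 mnm0E => /(_ isT).
rewrite !big_cons.
have catE : component_list (i :: r) ++ other_edges =
  component_edges i ++ (component_list r ++ other_edges).
  by rewrite catA.
rewrite catE map_cat; apply: face_homology_join IH.
- exact: toric_semigroupD.
- exact: toric_semigroup_separated.
have := hF i; rewrite -(size_map (@edge_mnm (H i))).
move=> /(face_homology_transport (@toric_semigroup_push i)
  (fun x g => mpush_le (@phi__inj i) x g) (fun x g => mpushB (@phi__inj i) g
    x)).
by rewrite -map_comp (eq_map (fun e => esym (epsE e))) map_comp.
Qed.

Lemma betti_components (F : min_graded_free_resolution k G)
    (FH : forall i, min_graded_free_resolution k (H i)) (a j : 'I_s -> nat) :
  (forall i, betti (FH i) (a i) (j i) <> 0%N) ->
  betti F (\sum_i a i) (\sum_i j i) <> 0%N.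
Proof.
move=> aj; have /fin_all_exists[h hE] : forall i, exists h,
    mdeg h = (2 * j i)%N /\
    face_homology_neq0 k (@toric_semigroup (H i))
     (map (@edge_mnm (H i)) (enum 'I_#|edges (H i)|)) h (a i)
     (size (enum 'I_#|edges (H i)|)).
  move=> i; have eT (e : 'I_#|edges (H i)|) : e \in enum 'I_#|edges (H i)|.
    by rewrite mem_enum.
  have [h hj hF] := (betti_face (FH i) (a i) (j i) (enum_uniq _) eT).1 (aj i).
  by exists h.
(* The components follow one another as in the iterated join, and the remaining edges come last. *)
apply/(@betti_face _ _ _ (component_list (enum 'I_s) ++ other_edges)).
- rewrite cat_uniq component_list_uniq ?enum_uniq //= filter_uniq ?enum_uniq //
  andbT.
  apply/hasPn => e; rewrite mem_filter => /andP[/forallP eN _].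
  by apply/negP => /component_listP[i _ ei]; have := eN i; rewrite ei.
- move=> e; rewrite mem_cat mem_filter mem_enum andbT.
  apply/orP; have [/forallP|] := boolP [forall i, e \notin component_edges i];
    first by right.
  rewrite negb_forall => /existsP[i]; rewrite negbK => ei; left.
  by apply/component_listP; exists i; rewrite ?mem_enum.
exists (\sum_(i <- enum 'I_s) push i (h i))%MM.
  rewrite mdeg_sum big_distrr /= big_enum /=; apply: eq_bigr => i _.
  by rewrite /push mdeg_mpush (hE i).1.
have <- : (\sum_(i <- enum 'I_s) a i = \sum_i a i)%N by rewrite big_enum.
by apply: face_homology_components => [|i]; [apply: enum_uniq|case: (hE i)].
Qed.
End DisjointSubgraphs.

Theorem theorem3p7 (k : fieldType) (G : sgraph) (s : nat) (H : 'I_s -> sgraph)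
    (U : {set G}) (hU : graph_iso (induced U) (disjoint_union H)) :
  (forall (r : int) (rH : 'I_s -> int),
      is_reg k G r -> (forall i, is_reg k (H i) (rH i)) ->
      \sum_(i < s) rH i <= r) /\
  (forall (p : nat) (pH : 'I_s -> nat),
      is_pd k G p -> (forall i, is_pd k (H i) (pH i)) ->
      (\sum_(i < s) pH i <= p)%N).
Proof.
have [phi phi_inj phi_adj] : exists2 phi : disjoint_union H -> G,
    injective phi & forall x y, adj (phi x) (phi y) = disjoint_union_adj x y.
  (* The inverse isomorphism embeds the disjoint union into [G] through the subset [U]. *)
  case: hU => f [[g fK gK] f_adj]; exists (fun x => val (g x)).
    by move=> x y /val_inj; apply: can_inj gK _ _.
  by move=> x y; rewrite -[RHS]/(adj x y) -{2}(gK x) -{2}(gK y) f_adj.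
have betti_sum := betti_components phi_inj phi_adj.
have sumZ (f : 'I_s -> nat) : \sum_i (f i)%:Z = (\sum_i f i)%N%:Z.
  by rewrite (big_morph Posz PoszD (erefl 0%:Z)).
split=> [r rH [F [_ Fmax]] HF|p pH [F [_ Fmax]] HF].
  have /fin_all_exists[FH /fin_all_exists[a /fin_all_exists[j aj]]] :
      forall i, exists (FH : min_graded_free_resolution k (H i)) (a j : nat),
      betti FH a j <> 0%N /\ rH i = j%:Z - a%:Z.
    move=> i; have [FH [[a [j [/eqP aj rE]]] _]] := HF i.
    by exists FH, a, j.
  (* The pairs [(a i, j i)] attain the regularities of the [H i]; the maximum for [G] bounds the
     difference of their sums. *)
  apply: Fmax; exists (\sum_i a i)%N, (\sum_i j i)%N; split.
    by apply/eqP; apply: (betti_sum k F FH) => i; case: (aj i).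
  rewrite -!sumZ -sumrB; apply: eq_bigr => i _.
  by case: (aj i).
have /fin_all_exists[FH /fin_all_exists[j pj]] :
    forall i, exists (FH : min_graded_free_resolution k (H i)) (j : nat),
    betti FH (pH i) j <> 0%N.
  move=> i; have [FH [[j /eqP pj] _]] := HF i.
  by exists FH, j.
apply: (Fmax (\sum_(i < s) pH i)%N); exists (\sum_i j i)%N.
by apply/eqP; apply: (betti_sum k F FH).
Qed.
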